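(* Let $P_0$ be a three-dimensional smooth lattice polytope. Suppose that there are no two adjacent facets $F_1,F_2$ of $P_0$ such that every vertex of $P_0$ lies on $F_1$ or $F_2$. Then $P=\mathrm{Pop}(P_0)$ has the property that no admissible cocharacter $v\in N$ makes $P$ $v$-well-rounded.
   Context: Work over an algebraically closed field $\mathbb{K}$; subvarieties are closed and irreducible. Let $T$ be an algebraic torus with character lattice $M$ and cocharacter lattice $N=\mathrm{Hom}(\mathbb{G}_m,T)$. A full-dimensional lattice polytope $P\subset M_{\mathbb{R}}$ is smooth if at each vertex the primitive edge directions form a $\mathbb{Z}$-basis of $M$; its outer normal fan in $N_{\mathbb{R}}$ then defines a smooth projective toric variety $X$ with dense torus $T$. For a smooth lattice polytope $P_0$ with toric variety $X_0$, $\mathrm{Pop}(P_0)$ denotes the smooth polytope obtained from a suitable dilation of $P_0$ by truncating at every vertex by a hyperplane meeting each edge incident to that vertex at the lattice point nearest to the vertex (the dilation being large enough that this is combinatorially the truncation of $P_0$ at all vertices); its toric variety is the blowup of $X_0$ at all its $T$-fixed points. For a smooth polytope $P$ with toric variety $X$, a cocharacter $v\in N$ is admissible if $X^{\mathbb{G}_m}=X^T$ for the $\mathbb{G}_m$-action induced by $v$ (equivalently, $v$ is not perpendicular to any edge of $P$). For $p\in X^{\mathbb{G}_m}$, $X_p^+=\{x\in X:\lim_{t\to0}v(t)\cdot x=p\}$. A $\mathbb{G}_m$-stable subvariety $Y\subseteq X$ is $\mathbb{G}_m$-convex if for every $\mathbb{G}_m$-stable subvariety $Z\subseteq X$: $Z\subseteq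 Y$ if and only if $Z^{\mathbb{G}_m}\subseteq Y^{\mathbb{G}_m}$. $P$ (or $X$) is $v$-well-rounded if every closure $\overline{X_p^+}$, $p\in X^{\mathbb{G}_m}$, is $\mathbb{G}_m$-convex. *)

(* Defs.v *)
From mathcomp Require Import all_boot all_order all_algebra.
From mathcomp Require Import boolp classical_sets reals.

Set Implicit Arguments.
Unset Strict Implicit.
Unset Printing Implicit Defensive.

Import Order.TTheory GRing.Theory Num.Theory.

Local Open Scope classical_set_scope.
Local Open Scope ring_scope.

(* After a choice of coordinates, T = (G_m)^n, the character lattice M is
   'rV[int]_n and the cocharacter lattice N is its dual 'cV[int]_n. *)
Definition pairing (A : pzSemiRingType) (n : nat)
    (m : 'rV[A]_n) (u : 'cV[A]_n) : A := (m *m u) 0 0.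

Section Polytopes.
Variables (R : realType) (n : nat).
Local Notation M := 'rV[int]_n.
Local Notation MR := 'rV[R]_n.
Local Notation NR := 'cV[R]_n.
Implicit Types (P F E : set MR) (w x y : MR) (e m : M) (a u : NR).

Definition lattice_pt (m : M) : MR := map_mx intr m.

Definition convex_hull (s : seq M) : set MR :=
  [set x | exists c : 'I_(size s) -> R,
    [/\ forall i, 0 <= c i, \sum_i c i = 1 &
        x = \sum_i c i *: lattice_pt (nth 0 s i)]].

Definition lattice_polytope P := exists s : seq M, P = convex_hull s.

(* F has affine dimension d: the rows of A are d independent differences of
   points of F, and they span all differences x - x0 with x in F. *)
Definition has_dim F (d : nat) :=
  exists (x0 : MR) (A : 'M[R]_(d, n)),
    [/\ F x0, row_free A, forall i, F (x0 + row i A) &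
        forall x, F x -> (x - x0 <= A)%MS].

(* Nonempty faces only; P itself is included, with u = 0. *)
Definition face P F := (exists x, F x) /\
  exists u, F = [set x | P x /\ forall y, P y -> pairing y u <= pairing x u].

Definition vertex P w := face P [set w].
Definition edge P E := face P E /\ has_dim E 1.
Definition facet P F := face P F /\ has_dim F n.-1.

Definition adjacent_facets P F1 F2 :=
  [/\ facet P F1, facet P F2, face P (F1 `&` F2) & has_dim (F1 `&` F2) n.-2].

(* The clause with k = 0 excludes e = 0. *)
Definition primitive e := forall (e' : M) (k : nat), e = e' *+ k -> k = 1%N.

Definition edge_direction P w e :=
  primitive e /\
  exists E (c : R), [/\ edge P E, E w, 0 < c & E (w + c *: lattice_pt e)].

(* The rows of a unimodular matrix are exactly a Z-basis of M. *)
Definition smooth_polytope P :=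
  [/\ lattice_polytope P, has_dim P n &
      forall w, vertex P w ->
        exists2 B : 'M[int]_n, B \in unitmx &
          forall e, edge_direction P w e <-> exists i, e = row i B].

Definition dilation (k : nat) P : set MR := [set x *+ k | x in P].

(* The hyperplane <-, a> = b passes through w + e for every primitive edge
   direction e at w, i.e. it meets each edge at w in the lattice point nearest
   to w; it is oriented so that w lies on the side that is cut off. *)
Definition cutting_hyperplane P w a (b : R) :=
  pairing w a < b /\
  forall e, edge_direction P w e -> pairing (w + lattice_pt e) a = b.

Definition truncation P : set MR :=
  [set x | P x /\ forall w a b, vertex P w -> cutting_hyperplane P w a b ->
                   b <= pairing x a].

(* The corners cut off at distinct vertices are disjoint, cutting hyperplanes
   included; this is when [truncation P] is combinatorially the truncation of
   P at all of its vertices. *)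
Definition disjoint_corners P :=
  forall w w' a a' b b', vertex P w -> vertex P w' -> w <> w' ->
    cutting_hyperplane P w a b -> cutting_hyperplane P w' a' b' ->
    forall x, P x -> ~ (pairing x a <= b /\ pairing x a' <= b').

Definition is_Pop P0 P :=
  exists k : nat, [/\ (0 < k)%N, disjoint_corners (dilation k P0) &
                      P = truncation (dilation k P0)].

Definition outer_normal_cone P F : set NR :=
  [set u | forall x y, F x -> P y -> pairing y u <= pairing x u].

Definition outer_normal_fan P : set (set NR) :=
  [set outer_normal_cone P F | F in face P].

Definition dual_cone (sigma : set NR) : set M :=
  [set m | forall u, sigma u -> 0 <= pairing (lattice_pt m) u].

Definition orthogonal_lattice (sigma : set NR) : set M :=
  [set m | forall u, sigma u -> pairing (lattice_pt m) u = 0].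

End Polytopes.

Section ToricVariety.
Variables (R : realType) (K : closedFieldType) (n : nat).
Local Notation M := 'rV[int]_n.
Local Notation N := 'cV[int]_n.
Local Notation cone := (set 'cV[R]_n).
Variable Sigma : set cone.

(* A K-point of X_Sigma is given by the smallest chart U_tau containing it and
   the semigroup morphism tau^dual /\ M -> K that it defines there.  A morphism
   gamma lies in no smaller chart iff it is nonzero exactly on tau^perp /\ M;
   gamma is extended by 0 outside tau^dual, so that (tau, gamma) is unique. *)
Definition point : Type := (cone * (M -> K))%type.
Implicit Types (x p : point) (Y Z C : set point).

Definition toric_variety : set point :=
  [set x | [/\ Sigma x.1, x.2 0 = 1,
      forall m m', dual_cone x.1 m -> dual_cone x.1 m' ->
        x.2 (m + m') = x.2 m * x.2 m' &
      forall m, x.2 m != 0 <-> orthogonal_lattice x.1 m]].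

Local Notation X := toric_variety.

(* For tau, sigma in the fan, tau is a face of sigma iff it is a subset; the
   character m in sigma^dual takes the value x.2 m at a point x of U_sigma. *)
Definition chart (sigma : cone) : set point := [set x | X x /\ x.1 `<=` sigma].

(* Elements of K[sigma^dual /\ M], as lists of terms c * chi^m. *)
Definition regular_function (sigma : cone) (f : seq (K * M)) :=
  forall t, t \in f -> dual_cone sigma t.2.

Definition eval_function (f : seq (K * M)) (x : point) : K :=
  \sum_(t <- f) t.1 * x.2 t.2.

Definition zariski_closed C :=
  C `<=` X /\
  forall sigma, Sigma sigma ->
    exists I : set (seq (K * M)),
      (forall f, I f -> regular_function sigma f) /\
      forall x, chart sigma x ->
        (C x <-> forall f, I f -> eval_function f x = 0).

Definition zariski_closure Y : set point :=
  [set x | forall C, zariski_closed C -> Y `<=` C -> C x].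

Definition irreducible Y :=
  (exists x, Y x) /\
  forall C1 C2, zariski_closed C1 -> zariski_closed C2 ->
    Y `<=` C1 `|` C2 -> Y `<=` C1 \/ Y `<=` C2.

Definition subvariety Y := zariski_closed Y /\ irreducible Y.

(* T(K) = Hom(M, K^* ) *)
Definition torus : set (M -> K) :=
  [set s | s 0 = 1 /\ forall m m', s (m + m') = s m * s m'].

Definition torus_act (s : M -> K) (x : point) : point :=
  (x.1, fun m => s m * x.2 m).

(* The element v(t) of T, for t in K^* *)
Definition cocharacter (v : N) (t : K) : M -> K := fun m => t ^ pairing m v.

Definition T_fixed Y : set point :=
  [set x | Y x /\ forall s, torus s -> torus_act s x = x].

Variable v : N.

Definition Gm_act (t : K) (x : point) : point := torus_act (cocharacter v t) x.

Definition Gm_fixed Y : set point :=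
  [set x | Y x /\ forall t, t != 0 -> Gm_act t x = x].

Definition admissible := Gm_fixed X = T_fixed X.

(* The orbit morphism G_m -> X, t |-> v(t) x extends to a morphism A^1 -> X
   with 0 |-> p.  Since charts are T-stable, such an extension takes values in
   a chart U_sigma containing x and p, where it amounts to extending the
   pullback of each character in sigma^dual to a polynomial in t. *)
Definition limit_at_0 (x p : point) :=
  exists sigma, [/\ Sigma sigma, chart sigma x, chart sigma p &
    forall m, dual_cone sigma m ->
      exists f : {poly K},
        (forall t, t != 0 -> f.[t] = (Gm_act t x).2 m) /\ f.[0] = p.2 m].

Definition plus_cell (p : point) : set point := [set x | X x /\ limit_at_0 x p].

Definition Gm_stable Y := forall t x, t != 0 -> Y x -> Y (Gm_act t x).

Definition Gm_stable_subvariety Y := subvariety Y /\ Gm_stable Y.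

Definition Gm_convex Y :=
  Gm_stable_subvariety Y /\
  forall Z, Gm_stable_subvariety Z ->
    (Z `<=` Y <-> Gm_fixed Z `<=` Gm_fixed Y).

Definition well_rounded :=
  forall p, Gm_fixed X p -> Gm_convex (zariski_closure (plus_cell p)).

End ToricVariety.

Section PolytopeNotions.
Variables (R : realType) (K : closedFieldType) (n : nat).
Variables (P : set 'rV[R]_n) (v : 'cV[int]_n).

Definition polytope_admissible := admissible K (outer_normal_fan P) v.
Definition polytope_well_rounded := well_rounded K (outer_normal_fan P) v.

End PolytopeNotions.
Arguments polytope_admissible {R} K {n} P v.
Arguments polytope_well_rounded {R} K {n} P v.

(* Main.v *)
(* Let y* be the vertex of P at which v is maximal; it lies on an edge E of P0
   next to a vertex of P0, and the only facets of P through it coming from P0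
   are the two facets of P0 containing E.  By hypothesis some vertex w of P0
   lies on neither.  Let a, b, c be the vertices of the triangle that replaces
   w, with v(a) < v(b) < v(c), and let F be the facet of P0 such that its
   truncation F' contains the edge ac of the triangle.  Since F' misses y*, the
   third edge at the v-maximal vertex y of F' is v-increasing, so the closure of
   the plus cell of y is the orbit closure of F'.  The G_m-orbit closure of the
   unit point of the triangle's orbit has fixed points a and c only, which lie in
   F', but is not contained in the orbit closure of F'. *)
Require Import Defs.
From mathcomp Require Import all_boot all_order all_algebra.
From mathcomp Require Import boolp classical_sets reals.
From mathcomp Require Import ring lra.

Set Implicit Arguments.
Unset Strict Implicit.
Unset Printing Implicit Defensive.

Import Order.TTheory GRing.Theory Num.Theory.

Local Open Scope classical_set_scope.
Local Open Scope ring_scope.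

(** The fan consists of outer normals, so the characters regular at a vertex are nonpositive
    combinations of its edge directions, and for t tending to 0 an admissible v(t) pushes a point
    towards the v-maximal vertex of its face. No closure is computed exactly. Closures are bounded
    from below by limits along one-parameter subgroups, not always [v] itself, and from above by
    explicit closed sets of two kinds: the complement of the chart at a vertex, and a binomial
    locus. The first kind keeps the closed plus cell of y out of the chart at b, because b lies off
    F', and it confines the fixed points of the orbit closure in the triangle to a, b, c. The second
    kind rules out b: as v(b) lies strictly between v(a) and v(c), positive exponents exist for
    which a binomial in a, b, c is invariant under v. *)

Lemma addrKl (V : zmodType) (a b : V) : a + b - a = b.
Proof. by rewrite addrAC subrr add0r. Qed.

(** * Bilinearity of the pairing, and lattice points in real coordinates *)

Section Pairing.
Variables (A : pzRingType) (n : nat).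
Implicit Types (x y : 'rV[A]_n) (u w : 'cV[A]_n).

Lemma pairingDl x y u : pairing (x + y) u = pairing x u + pairing y u.
Proof. by rewrite /pairing mulmxDl mxE. Qed.

Lemma pairingNl x u : pairing (- x) u = - pairing x u.
Proof. by rewrite /pairing mulNmx mxE. Qed.

Lemma pairingBl x y u : pairing (x - y) u = pairing x u - pairing y u.
Proof. by rewrite pairingDl pairingNl. Qed.

Lemma pairingZl (c : A) x u : pairing (c *: x) u = c * pairing x u.
Proof. by rewrite /pairing -scalemxAl mxE. Qed.

Lemma pairing0l u : pairing 0 u = 0.
Proof. by rewrite /pairing mul0mx mxE. Qed.

Lemma pairingMnl x u (k : nat) : pairing (x *+ k) u = pairing x u *+ k.
Proof. by elim: k => [|k IH]; rewrite ?pairing0l // !mulrS pairingDl IH. Qed.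

Lemma pairing_suml (I : finType) (F : I -> 'rV[A]_n) u :
  pairing (\sum_i F i) u = \sum_i pairing (F i) u.
Proof. by rewrite /pairing mulmx_suml summxE. Qed.

Lemma pairingDr x u w : pairing x (u + w) = pairing x u + pairing x w.
Proof. by rewrite /pairing mulmxDr mxE. Qed.

Lemma pairingNr x u : pairing x (- u) = - pairing x u.
Proof. by rewrite /pairing mulmxN mxE. Qed.

Lemma pairing_sumr (I : finType) (Q : pred I) x (F : I -> 'cV[A]_n) :
  pairing x (\sum_(i | Q i) F i) = \sum_(i | Q i) pairing x (F i).
Proof. by rewrite /pairing mulmx_sumr summxE. Qed.

Lemma pairing_row m p (B : 'M[A]_(m, n)) (D : 'M[A]_(n, p)) i j :
  pairing (row i B) (col j D) = (B *m D) i j.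
Proof. by rewrite /pairing !mxE; apply: eq_bigr => k _; rewrite !mxE. Qed.

End Pairing.

Lemma pairingZr (A : comPzRingType) n (c : A) (x : 'rV[A]_n) u :
  pairing x (c *: u) = c * pairing x u.
Proof. by rewrite /pairing -scalemxAr mxE. Qed.

Section LatticePoints.
Variables (R : realType) (n : nat).
Implicit Types (m e : 'rV[int]_n).

Lemma lattice_ptD m m' : lattice_pt R (m + m') = lattice_pt R m + lattice_pt R m'.
Proof. exact: map_mxD. Qed.

Lemma lattice_ptN m : lattice_pt R (- m) = - lattice_pt R m.
Proof. exact: map_mxN. Qed.

Lemma lattice_ptB m m' : lattice_pt R (m - m') = lattice_pt R m - lattice_pt R m'.
Proof. exact: map_mxB. Qed.

Lemma lattice_pt0 : lattice_pt R (0 : 'rV[int]_n) = 0.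
Proof. exact: map_mx0. Qed.

Lemma lattice_ptMn m k : lattice_pt R (m *+ k) = lattice_pt R m *+ k.
Proof. by elim: k => [|k IH]; rewrite ?lattice_pt0 // !mulrS lattice_ptD IH. Qed.

Lemma lattice_pt_inj : injective (@lattice_pt R n).
Proof.
move=> m m' /rowP E; apply/rowP => i; have := E i; rewrite !mxE; exact: intr_inj.
Qed.

Lemma pairing_lattice m (v : 'cV[int]_n) :
  pairing (lattice_pt R m) (map_mx intr v) = (pairing m v)%:~R.
Proof. by rewrite /pairing /lattice_pt -map_mxM mxE. Qed.

Lemma row_lattice_pt p (B : 'M[int]_(p, n)) i :
  lattice_pt R (row i B) = row i (map_mx intr B).
Proof. exact: map_row. Qed.

End LatticePoints.

(** * Finite maxima and perturbed functionals *)

Section Finite.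

Lemma seq_max (R : realType) (T : eqType) (s : seq T) (f : T -> R) :
  s != [::] -> exists2 z, z \in s & forall m, m \in s -> f m <= f z.
Proof.
elim: s => // a s IH _; have [->|s0] := eqVneq s [::].
  by exists a; rewrite ?inE // => m; rewrite inE => /eqP->.
have [z zs zmax] := IH s0; have [az|za] := leP (f a) (f z).
  exists z; first by rewrite inE zs orbT.
  by move=> m; rewrite inE => /predU1P[->|/zmax].
exists a; first by rewrite inE eqxx.
move=> m; rewrite inE => /predU1P[->//|/zmax H]; exact: le_trans H (ltW za).
Qed.

(** Each pair consists of a gap to be preserved and the rate at which a perturbation eats it. The
    bound is stated for all smaller multipliers so that the induction can take a minimum. *)
Lemma small_multiplier (R : realType) (s : seq (R * R)) :
  exists2 e, 0 < e & forall e' p, 0 < e' <= e -> p \in s -> 0 < p.1 ->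
    e' * p.2 < p.1.
Proof.
elim: s => [|[a b] s [e e0 IH]]; first by exists 1.
have [a0|a0] := leP a 0.
  exists e => // e' p He; rewrite inE => /predU1P[->/=|]; last exact: IH.
  by move=> /(le_lt_trans a0); rewrite ltxx.
have b1 : 0 < `|b| + 1 by rewrite ltr_pwDr.
exists (Num.min e (a / (`|b| + 1))); first by rewrite lt_min e0 divr_gt0.
move=> e' p /andP[e'0]; rewrite le_min => /andP[e'e e'a].
rewrite inE => /predU1P[->/= _|]; last by apply: IH; rewrite e'0.
apply: (@lt_le_trans _ _ (e' * (`|b| + 1))).
  by rewrite ltr_pM2l // (le_lt_trans (ler_norm b)) // ltrDl.
by rewrite -ler_pdivlMr.
Qed.

End Finite.

Section Exposed.
Variables (R : realType) (n : nat).
Implicit Types (x y h : 'rV[R]_n) (u g : 'cV[R]_n) (s : seq 'rV[R]_n).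

(** Adding a small multiple of [g] to [u] keeps the finitely many strict inequalities and lets [g]
    break the ties. *)
Lemma lexicographic_functional s u g : exists u',
  forall x y, x \in s -> y \in s ->
    (pairing x u < pairing y u -> pairing x u' < pairing y u') /\
    (pairing x u = pairing y u ->
       (pairing x u' < pairing y u') = (pairing x g < pairing y g)).
Proof.
pose l := [seq (pairing y u - pairing x u, pairing x g - pairing y g)
            | x <- s, y <- s].
have [e e0 He] := small_multiplier l.
exists (u + e *: g) => x y xs ys; rewrite !pairingDr !pairingZr; split.
  move=> xy.
  have pl : (pairing y u - pairing x u, pairing x g - pairing y g) \in l.
    exact: allpairs_f.
  have := He e _ _ pl; rewrite e0 lexx subr_gt0 => /(_ isT xy) /=; lra.
by move=> ->; rewrite ltrD2l ltr_pM2l.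
Qed.

(** Expand |x - h|^2 > 0; the transpose turns a vector into a functional. *)
Lemma pairing_norm_lt x h : x != h ->
  pairing x x^T <= pairing h h^T -> pairing x h^T < pairing h h^T.
Proof.
move=> xh le.
have E a b : pairing (a : 'rV[R]_n) b^T = \sum_i a 0 i * b 0 i.
  by rewrite /pairing mxE; apply: eq_bigr => i _; rewrite mxE.
have C : pairing x h^T = pairing h x^T.
  by rewrite !E; apply: eq_bigr => i _; rewrite mulrC.
suff : 0 < pairing (x - h) (x - h)^T.
  by rewrite linearB /= pairingBl !pairingDr !pairingNr -C; lra.
rewrite E lt_def sumr_ge0 ?andbT; last by move=> i _; rewrite -expr2 sqr_ge0.
apply: contraNneq xh => S0; rewrite -subr_eq0; apply/eqP/rowP => i.
have /psumr_eq0P : forall j : 'I_n, true -> 0 <= (x - h) 0 j * (x - h) 0 j.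
  by move=> j _; rewrite -expr2 sqr_ge0.
by move=> /(_ S0 i isT)/eqP; rewrite mulf_eq0 orbb => /eqP ->; rewrite mxE.
Qed.

(* Among the maximizers of u, one of largest Euclidean norm is the unique
   maximizer of a perturbation of u. *)
Lemma exposed_max s u : s != [::] -> exists h u',
  [/\ h \in s, forall x, x \in s -> pairing x u <= pairing h u &
      forall x, x \in s -> x != h -> pairing x u' < pairing h u'].
Proof.
move=> s0; have [z zs zmax] := seq_max (fun x => pairing x u) s0.
pose s1 := [seq x <- s | pairing x u == pairing z u].
have s10 : s1 != [::].
  apply/eqP => E; have : z \in s1 by rewrite mem_filter eqxx.
  by rewrite E.
have [h] := seq_max (fun x => pairing x x^T) s10.
rewrite mem_filter => /andP[/eqP hz hs] hmax.
have [u' Hu'] := lexicographic_functional s u h^T.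
exists h, u'; split => // [x /zmax|x xs xh]; first by rewrite hz.
have [lt eq] := Hu' x h xs hs.
have := zmax x xs; rewrite le_eqVlt => /predU1P[E|]; last by rewrite -hz.
rewrite eq ?hz //; apply: pairing_norm_lt xh _; apply: hmax.
by rewrite mem_filter E eqxx.
Qed.

Lemma exposed_lex_max s u g : s != [::] -> exists h u',
  [/\ h \in s, forall x, x \in s -> pairing x u <= pairing h u,
      forall x, x \in s -> pairing x u = pairing h u ->
        pairing x g <= pairing h g &
      forall x, x \in s -> x != h -> pairing x u' < pairing h u'].
Proof.
move=> s0; have [u1 Hu1] := lexicographic_functional s u g.
have [h [u' [hs hmax hu']]] := exposed_max u1 s0.
exists h, u'; split => // x xs; have [lt eq] := Hu1 h x hs xs.
  by rewrite leNgt; apply/negP => /lt; rewrite ltNge hmax.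
by move=> E; rewrite leNgt -eq // -leNgt hmax.
Qed.

End Exposed.

(** * Faces and vertices of a convex hull of lattice points *)

Section Hull.
Variables (R : realType) (n : nat) (s : seq 'rV[int]_n).
Local Notation Q := (@convex_hull R n s).
Local Notation lat := (@lattice_pt R n).
Implicit Types (x y : 'rV[R]_n) (u g : 'cV[R]_n) (m : 'rV[int]_n).

Lemma hull_le x u (c : R) : Q x ->
  (forall m, m \in s -> pairing (lat m) u <= c) -> pairing x u <= c.
Proof.
move=> [l [l0 l1 ->]] H; rewrite pairing_suml -[c]mul1r -l1 mulr_suml.
by apply: ler_sum => i _; rewrite pairingZl ler_wpM2l // H // mem_nth.
Qed.

Lemma hull_mem m : m \in s -> Q (lat m).
Proof.
move=> ms; have lt : (index m s < size s)%N by rewrite index_mem.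
exists (fun i => (i == Ordinal lt)%:R); split.
- by move=> i; rewrite ler0n.
- by rewrite (bigD1 (Ordinal lt)) //= eqxx big1 ?addr0 // => i /negbTE->.
rewrite (bigD1 (Ordinal lt)) //= eqxx scale1r nth_index // big1 ?addr0 //.
by move=> i /negbTE->; rewrite scale0r.
Qed.

Lemma hull_convex x y (t : R) : 0 <= t <= 1 -> Q x -> Q y ->
  Q ((1 - t) *: x + t *: y).
Proof.
move=> /andP[t0 t1] [l [l0 l1 ->]] [l' [l'0 l'1 ->]].
exists (fun i => (1 - t) * l i + t * l' i); split.
- by move=> i; rewrite addr_ge0 // mulr_ge0 // subr_ge0.
- by rewrite big_split /= -!mulr_sumr l1 l'1; lra.
rewrite !scaler_sumr -big_split /=; apply: eq_bigr => i _.
by rewrite !scalerA -scalerDl.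
Qed.

(** A weighted average of numbers at most [c] reaches [c] only if every nonzero weight sits on an
    equality. *)
Lemma hull_face x u (c : R) : Q x ->
  (forall m, m \in s -> pairing (lat m) u <= c) -> pairing x u = c ->
  exists l : 'I_(size s) -> R,
    [/\ forall i, 0 <= l i, \sum_i l i = 1,
        x = \sum_i l i *: lat (nth 0 s i) &
        forall i, l i != 0 -> pairing (lat (nth 0 s i)) u = c].
Proof.
move=> [l [l0 l1 xE]] H xu; exists l; split => // i li.
have E : \sum_i l i * (c - pairing (lat (nth 0 s i)) u) = 0.
  rewrite (eq_bigr (fun i => l i * c - l i * pairing (lat (nth 0 s i)) u)).
    rewrite sumrB -mulr_suml l1 mul1r; apply/eqP; rewrite subr_eq0 -{1}xu xE.
    by rewrite pairing_suml; apply/eqP/eq_bigr => j _; rewrite pairingZl.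
  by move=> j _; rewrite mulrBr.
have /psumr_eq0P : forall j : 'I_(size s), true ->
    0 <= l j * (c - pairing (lat (nth 0 s j)) u).
  by move=> j _; rewrite mulr_ge0 // subr_ge0 H // mem_nth.
move=> /(_ E i isT)/eqP; rewrite mulf_eq0 (negbTE li) subr_eq0 /=.
by move=> /eqP.
Qed.

Lemma hull_vertex z u : z \in s ->
  (forall m, m \in s -> m != z -> pairing (lat m) u < pairing (lat z) u) ->
  vertex Q (lat z).
Proof.
move=> zs H.
have Hle m : m \in s -> pairing (lat m) u <= pairing (lat z) u.
  by have [->//|mz ms] := eqVneq m z; apply: ltW; apply: H.
split; first by exists (lat z).
exists u; apply/seteqP; split => [x -> /=|x [Qx xmax]].
  split; first exact: hull_mem.
  by move=> y Qy; apply: hull_le.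
have xu : pairing x u = pairing (lat z) u.
  apply/eqP; rewrite eq_le hull_le //=; apply: xmax; exact: hull_mem.
have [l [l0 l1 -> lz]] := hull_face Qx Hle xu; rewrite /=.
rewrite -[in RHS](scale1r (lat z)) -l1 scaler_suml /=; apply: eq_bigr => i _.
have [->|/lz E] := eqVneq (l i) 0; first by rewrite !scale0r.
have [->//|nz] := eqVneq (nth 0 s i) z.
by have := H _ (mem_nth 0 (ltn_ord i)) nz; rewrite E ltxx.
Qed.

(** Source of all vertices: a perturbed functional has a single generator as its maximizer, which is
    thereby exposed. With [u] defining a face, the result is the [g]-maximal vertex of that face. *)
Lemma lex_max_vertex u g : (exists x, Q x) -> exists z,
  [/\ z \in s, vertex Q (lat z), forall x, Q x -> pairing x u <= pairing (lat z) u &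
      forall x, Q x -> pairing x u = pairing (lat z) u ->
        pairing x g <= pairing (lat z) g].
Proof.
move=> [x0 [l0 [_ l01 _]]].
have s0 : map lat s != [::].
  rewrite -size_eq0 size_map; apply/eqP => E; move: l0 l01; rewrite E => l0.
  by rewrite big_ord0 => /eqP; rewrite eq_sym oner_eq0.
have [h [u' [/mapP[z zs ->] hu hg hu']]] := exposed_lex_max u g s0.
have zu m : m \in s -> pairing (lat m) u <= pairing (lat z) u.
  by move=> ms; apply: hu; apply: map_f.
exists z; split => //.
- apply: (@hull_vertex _ u') => // m ms mz; apply: hu'; first exact: map_f.
  by apply: contra mz => /eqP/lattice_pt_inj ->.
- by move=> x Qx; apply: hull_le.
move=> x Qx xu; have [l [l'0 l1 -> lz]] := hull_face Qx zu xu.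
rewrite pairing_suml -[leRHS]mul1r -l1 mulr_suml; apply: ler_sum => i _.
rewrite pairingZl; have [->|li] := eqVneq (l i) 0; first by rewrite !mul0r.
by rewrite ler_wpM2l // hg ?lz //; apply: map_f; apply: mem_nth.
Qed.

Lemma vertex_hull w : vertex Q w -> exists2 z, z \in s & w = lat z.
Proof.
move=> [_ [u uE]].
have : [set w] w by [].
rewrite uE => -[Qw wmax].
have [z [zs _ zu _]] := lex_max_vertex u u (ex_intro _ w Qw).
exists z => //; suff : [set w] (lat z) by [].
rewrite uE; split; first exact: hull_mem.
by move=> y Qy; apply: zu.
Qed.

End Hull.

(** * Closed sets, one-parameter orbits and limits in a toric variety *)

Section Torus.
Variables (R : realType) (K : closedFieldType) (n : nat).
Variable Sigma : set (set 'cV[R]_n).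
Local Notation pnt := (Defs.point R K n).
Local Notation X := (@toric_variety R K n Sigma).
Implicit Types (x p : pnt) (Y C : set pnt) (v : 'cV[int]_n) (t : K).

(** The factor ['X] makes 0 a root too, and a nonzero polynomial over an algebraically closed field
    has a nonroot. *)
Lemma poly_eq0_off0 (p : {poly K}) : (forall t, t != 0 -> p.[t] = 0) -> p = 0.
Proof.
move=> H; apply/eqP; apply: contraT => p0.
have /closed_nonrootP[t] : p * 'X != 0 by rewrite mulf_neq0 // polyX_eq0.
rewrite /root hornerM hornerX mulf_eq0 negb_or => /andP[pt t0].
by rewrite H ?eqxx in pt.
Qed.

Lemma orthogonal_dual (sigma : set 'cV[R]_n) m :
  orthogonal_lattice sigma m -> dual_cone sigma m.
Proof. by move=> H u /H ->. Qed.

Lemma orthogonal0 (sigma : set 'cV[R]_n) : orthogonal_lattice sigma 0.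
Proof. by move=> u _; rewrite lattice_pt0 pairing0l. Qed.

Lemma toric_eq0 x m : X x -> ~ orthogonal_lattice x.1 m -> x.2 m = 0.
Proof. by move=> [_ _ _ H] /H/negP; rewrite negbK => /eqP. Qed.

Lemma torus_cocharacter v t : t != 0 -> torus (cocharacter v t).
Proof.
move=> t0; split; first by rewrite /cocharacter pairing0l expr0z.
by move=> m m'; rewrite /cocharacter pairingDl expfzDr.
Qed.

Lemma torus_neq0 (s : 'rV[int]_n -> K) m : torus s -> s m != 0.
Proof.
move=> [s0 sD]; apply/eqP => E; have := sD m (- m).
by rewrite subrr s0 E mul0r => /eqP; rewrite oner_eq0.
Qed.

Lemma toric_act (s : 'rV[int]_n -> K) x : torus s -> X x -> X (torus_act s x).
Proof.
move=> Ts [Sx x0 xD xo]; have [s0 sD] := Ts; split => //=.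
- by rewrite s0 x0 mulr1.
- by move=> m m' dm dm'; rewrite sD xD //; ring.
by move=> m; rewrite mulf_eq0 negb_or torus_neq0 //=; apply: xo.
Qed.

Lemma toric_Gm_act v t x : t != 0 -> X x -> X (Gm_act v t x).
Proof. by move=> t0; apply: toric_act; apply: torus_cocharacter. Qed.

Lemma Gm_actM v t t' x : t != 0 -> t' != 0 ->
  Gm_act v t (Gm_act v t' x) = Gm_act v (t * t') x.
Proof.
move=> t0 t'0; rewrite /Gm_act /torus_act /=; congr (_, _).
by apply/funext => m; rewrite mulrA /cocharacter exprzMl // unitfE.
Qed.

Lemma Gm_act1 v x : Gm_act v 1 x = x.
Proof.
case: x => a b; rewrite /Gm_act /torus_act /cocharacter /=; congr (_, _).
by apply/funext => m; rewrite exp1rz mul1r.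
Qed.

Lemma chart_Gm_act v t x sigma : t != 0 ->
  chart Sigma sigma x -> chart Sigma sigma (Gm_act v t x).
Proof. by move=> t0 [Xx xs]; split => //; apply: toric_Gm_act. Qed.

Lemma toric_closed : zariski_closed Sigma X.
Proof.
by split => [x //|sigma _]; exists set0; split => [//|x [Xx _]]; split.
Qed.

Lemma closure_subset Y : Y `<=` zariski_closure Sigma Y.
Proof. by move=> x Yx C _; apply. Qed.

Lemma closure_min Y C : zariski_closed Sigma C -> Y `<=` C ->
  zariski_closure Sigma Y `<=` C.
Proof. by move=> HC YC x; apply. Qed.

(** In each chart take all regular functions vanishing on the closure. They include the equations of
    every closed set containing [Y], so their common zeros lie in all these sets. *)
Lemma closure_closed Y : Y `<=` X -> zariski_closed Sigma (zariski_closure Sigma Y).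
Proof.
move=> YX; split => [|sigma Ss]; first exact: closure_min toric_closed YX.
exists [set f | regular_function sigma f /\
  forall x, chart Sigma sigma x -> zariski_closure Sigma Y x -> eval_function f x = 0].
split => [f []//|x xs]; split => [Yx f [_ Hf]|H C HC YC]; first exact: Hf.
have [_ /(_ _ Ss)[I [Ireg HI]]] := HC; apply/(HI _ xs) => f If; apply: H.
split; first exact: Ireg.
by move=> y ys /(_ C HC YC)/(HI _ ys); apply.
Qed.

(** Pulling an equation back along the action of [t] multiplies the coefficient of chi^m by
    t^<m,v>. *)
Lemma closed_translate v t C : t != 0 -> zariski_closed Sigma C ->
  zariski_closed Sigma [set x | X x /\ C (Gm_act v t x)].
Proof.
move=> t0 [CX HC]; split => [x []//|sigma Ss].
have [I [Ireg HI]] := HC _ Ss.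
pose tw (f : seq (K * 'rV[int]_n)) := [seq (a.1 * t ^ pairing a.2 v, a.2) | a <- f].
exists [set tw f | f in I]; split.
  by move=> _ [f If <-] _ /mapP[a af ->]; apply: Ireg If a af.
move=> x xs; have E f : eval_function (tw f) x = eval_function f (Gm_act v t x).
  by rewrite /eval_function big_map; apply: eq_bigr => a _ /=; rewrite mulrA.
have tx := chart_Gm_act v t0 xs; split.
  by move=> [_ /(HI _ tx) H] _ [f If <-]; rewrite E; apply: H.
move=> H; split; first by case: xs.
by apply/(HI _ tx) => f If; rewrite -E; apply: H; exists f.
Qed.

Lemma closure_Gm_stable v Y : Y `<=` X -> Gm_stable v Y ->
  Gm_stable v (zariski_closure Sigma Y).
Proof.
move=> YX HY t x t0 Yx C HC YC.
suff : [set z | X z /\ C (Gm_act v t z)] x by case.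
apply: Yx; first exact: closed_translate.
by move=> y Yy; split; [exact: YX|apply: YC; exact: HY].
Qed.

(** Along an orbit a regular function is a Laurent polynomial in t; the factor t^N clears its
    denominators. *)
Lemma eval_orbit v (f : seq (K * 'rV[int]_n)) x : exists (N : nat) (p : {poly K}),
  forall t, t != 0 -> p.[t] = t ^+ N * eval_function f (Gm_act v t x).
Proof.
rewrite /eval_function; elim: f => [|a f [N [p IH]]].
  by exists 0%N, 0 => t _; rewrite big_nil horner0 mulr0.
case E: (pairing a.2 v) => [k|k].
  exists N, (p + (a.1 * x.2 a.2) *: 'X^(N + k)) => t t0.
  rewrite big_cons hornerD IH // hornerZ hornerXn /= {2}/cocharacter E exprD.
  by rewrite -exprnP; ring.
exists (N + k.+1)%N, (p * 'X^(k.+1) + (a.1 * x.2 a.2) *: 'X^N) => t t0.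
rewrite big_cons hornerD hornerM IH // hornerZ !hornerXn /= {2}/cocharacter E.
have -> : t ^ Negz k = (t ^+ k.+1)^-1 by [].
have T : t ^+ k.+1 != 0 by rewrite expf_neq0.
by rewrite exprD; field.
Qed.

Definition Gm_orbit v x : set pnt := [set y | exists2 t, t != 0 & y = Gm_act v t x].

(** The whole orbit stays in the chart of [x]. If neither closed set contained it, each would yield
    an equation pulling back to a nonzero polynomial in t, and the product of the two would vanish
    off 0. *)
Lemma Gm_orbit_irreducible v x : X x ->
  irreducible Sigma (zariski_closure Sigma (Gm_orbit v x)).
Proof.
move=> Xx; have Sx : Sigma x.1 by case: Xx.
have xs t : t != 0 -> chart Sigma x.1 (Gm_act v t x).
  by move=> t0; apply: chart_Gm_act => //; split.
split.
  by exists x; apply: closure_subset; exists 1; rewrite ?oner_neq0 ?Gm_act1.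
move=> C1 C2 HC1 HC2 sub; apply: contrapT => /not_orP[n1 n2].
have get C : zariski_closed Sigma C ->
    ~ zariski_closure Sigma (Gm_orbit v x) `<=` C ->
    exists (N : nat) (q : {poly K}), q != 0 /\
      forall t, t != 0 -> C (Gm_act v t x) -> t ^+ N * q.[t] = 0.
  move=> HC nC.
  have : ~ Gm_orbit v x `<=` C by move=> /(closure_min HC).
  move=> /existsNP[_ /not_implyP[[t0 t00 ->] nCt]].
  have [_ /(_ _ Sx)[I [_ HI]]] := HC.
  have : ~ forall f, I f -> eval_function f (Gm_act v t0 x) = 0.
    by move=> /(HI _ (xs _ t00)).
  move=> /existsNP[f /not_implyP[If /eqP ft0]].
  have [N [p Hp]] := eval_orbit v f x; exists N, p; split.
    apply: contraNneq ft0 => p0; have := Hp _ t00; rewrite p0 horner0.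
    by move/esym/eqP; rewrite mulf_eq0 expf_eq0 (negbTE t00) andbF.
  by move=> t tn0 /(HI _ (xs _ tn0))/(_ f If) E; rewrite Hp // E !mulr0.
have [N1 [p1 [p10 H1]]] := get _ HC1 n1.
have [N2 [p2 [p20 H2]]] := get _ HC2 n2.
have : p1 * p2 = 0.
  apply: poly_eq0_off0 => t t0; rewrite hornerM.
  have tn N : t ^+ N != 0 by rewrite expf_neq0.
  have : zariski_closure Sigma (Gm_orbit v x) (Gm_act v t x).
    by apply: closure_subset; exists t.
  move=> /sub[/(H1 _ t0)|/(H2 _ t0)] /eqP; rewrite mulf_eq0 (negbTE (tn _)) /= => /eqP->.
    by rewrite mul0r.
  by rewrite mulr0.
by move/eqP; rewrite mulf_eq0 (negbTE p10) (negbTE p20).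
Qed.

Lemma Gm_orbit_closure_subvariety v x : X x ->
  Gm_stable_subvariety Sigma v (zariski_closure Sigma (Gm_orbit v x)).
Proof.
move=> Xx; have OX : Gm_orbit v x `<=` X.
  by move=> _ [t t0 ->]; apply: toric_Gm_act.
split; first split; first exact: closure_closed.
  exact: Gm_orbit_irreducible.
apply: closure_Gm_stable => // t _ t0 [t' t'0 ->].
by exists (t * t'); rewrite ?mulf_neq0 ?Gm_actM.
Qed.

(** An equation of [C] pulls back to a polynomial in t whose value at 0 is the equation at [p]; it
    vanishes off 0, hence at 0. *)
Lemma limit_closed v x p C : zariski_closed Sigma C ->
  (forall t, t != 0 -> C (Gm_act v t x)) -> limit_at_0 Sigma v x p -> C p.
Proof.
move=> [_ HC] Cx [sigma [Ss xs ps Hlim]].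
have [I [Ireg HI]] := HC _ Ss; apply/(HI _ ps) => f If.
have [q [q1 <-]] : exists q : {poly K},
    (forall t, t != 0 -> q.[t] = eval_function f (Gm_act v t x)) /\
    q.[0] = eval_function f p.
  have := Ireg f If; rewrite /eval_function.
  elim: f {If} => [|a f IH] reg.
    by exists 0; split => [t _|]; rewrite big_nil horner0.
  have [q [q1 q0]] : exists q : {poly K},
    (forall t, t != 0 -> q.[t] = \sum_(a <- f) a.1 * (Gm_act v t x).2 a.2) /\
    q.[0] = \sum_(a <- f) a.1 * p.2 a.2.
    by apply: IH => b bf; apply: reg; rewrite inE bf orbT.
  have [g [g1 g0]] := Hlim a.2 (reg a (mem_head _ _)).
  exists (a.1 *: g + q); split => [t t0|]; rewrite hornerD hornerZ big_cons.
    by rewrite g1 // q1.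
  by rewrite g0 q0.
rewrite (@poly_eq0_off0 q) ?horner0 // => t t0; rewrite q1 //.
by move: (Cx t t0) => /(HI _ (chart_Gm_act v t0 xs)); apply.
Qed.

(** The unit point of the torus orbit attached to [sigma]. *)
Definition distinguished_pt (sigma : set 'cV[R]_n) : pnt :=
  (sigma, fun m => if `[< orthogonal_lattice sigma m >] then 1 else 0).

Lemma distinguished_orthogonal sigma m : orthogonal_lattice sigma m ->
  (distinguished_pt sigma).2 m = 1.
Proof. by move=> H /=; case: asboolP. Qed.

Lemma distinguished_not_orthogonal sigma m : ~ orthogonal_lattice sigma m ->
  (distinguished_pt sigma).2 m = 0.
Proof. by move=> H /=; case: asboolP. Qed.

(** Multiplicativity rests on the orthogonal lattice being a face of the dual cone: two nonnegative
    numbers with sum 0 are both 0. *)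
Lemma distinguished_toric sigma : Sigma sigma -> X (distinguished_pt sigma).
Proof.
move=> Ss; split => //.
- exact: distinguished_orthogonal (@orthogonal0 _).
- move=> m m' dm dm' /=; case: asboolP => [o|no].
    have om : orthogonal_lattice sigma m.
      move=> u su; apply/eqP; rewrite eq_le dm // andbT.
      have := o u su; rewrite lattice_ptD pairingDl => <-.
      by rewrite lerDl dm'.
    have om' : orthogonal_lattice sigma m'.
      by move=> u su; have := o u su; rewrite lattice_ptD pairingDl om // add0r.
    by rewrite !asboolT ?mulr1.
  case: asboolP => om; case: asboolP => om'; rewrite ?mulr0 ?mul0r //.
  by case: no => u su; rewrite lattice_ptD pairingDl om // om' // addr0.
by move=> m /=; case: asboolP; rewrite ?oner_neq0 ?eqxx.
Qed.

(** For [m] nonzero, the cocharacter [m^T] multiplies the nonzero value of chi^m at [x] by t^d with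
    d = |m|^2 > 0, and some nonzero t has t^d different from 1. *)
Lemma T_fixed_orthogonal x m : T_fixed X x -> orthogonal_lattice x.1 m -> m = 0.
Proof.
move=> [[_ _ _ Hx] fx] om; apply/eqP; apply: contraT => m0.
pose k := pairing m m^T.
have kE : k = \sum_i (m 0 i) ^+ 2.
  by rewrite /k /pairing mxE; apply: eq_bigr => i _; rewrite mxE.
have k0 : 0 < k.
  rewrite kE lt_def sumr_ge0 ?andbT; last by move=> i _; exact: sqr_ge0.
  apply: contraNneq m0 => S0; apply/eqP/rowP => i; rewrite mxE.
  have /psumr_eq0P : forall j : 'I_n, true -> 0 <= m 0 j ^+ 2.
    by move=> j _; exact: sqr_ge0.
  by move=> /(_ S0 i isT)/eqP; rewrite sqrf_eq0 => /eqP.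
have [d dE] : exists d : nat, k = d by exists `|k|%N; rewrite gez0_abs // ltW.
have d0 : (0 < d)%N by rewrite -ltz_nat -dE.
have /closed_nonrootP[t] : ('X * ('X^d - 1) : {poly K}) != 0.
  by rewrite mulf_neq0 ?polyX_eq0 // -size_poly_eq0 size_XnsubC.
rewrite /root hornerM hornerX hornerD hornerN hornerC hornerXn mulf_eq0 negb_or.
move=> /andP[t0 td].
have := fx _ (torus_cocharacter m^T t0); case: (x) Hx om => a b /= Hx om [/funeqP/(_ m)].
rewrite /cocharacter -/k dE -exprnP -[in RHS](mul1r (b m)).
move=> /mulIf; rewrite (Hx m).2 // => /(_ isT) E.
by rewrite E subrr eqxx in td.
Qed.

End Torus.

(** * Simple vertices and the normal cones of the faces through them *)

Section Frames.
Variables (R : realType) (n : nat).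
Local Notation lat := (@lattice_pt R n).
Implicit Types (P : set 'rV[R]_n) (y : 'rV[int]_n) (B : 'M[int]_n) (D : 'M[R]_n).
Implicit Types (x : 'rV[R]_n) (u : 'cV[R]_n) (J : pred 'I_n).

(* P is simple at y: its tangent cone there is generated by the rows of B,
   and the columns of D are the dual basis. *)
Definition frame P y B D : Prop :=
  [/\ P (lat y), map_mx intr B *m D = 1%:M,
      forall x, P x -> forall i, 0 <= pairing (x - lat y) (col i D) &
      forall i, exists2 c, 0 < c & P (lat y + c *: lat (row i B))].

(* The normal cone of the face at y spanned by the rows of B indexed by J. *)
Definition face_cone B J : set 'cV[R]_n :=
  [set u | forall i, pairing (lat (row i B)) u <= 0 /\
                     (J i -> pairing (lat (row i B)) u = 0)].

Section OneFrame.
Variables (P : set 'rV[R]_n) (y : 'rV[int]_n) (B : 'M[int]_n) (D : 'M[R]_n).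
Hypothesis fr : frame P y B D.

Lemma frame_dual i j : pairing (lat (row i B)) (col j D) = (i == j)%:R.
Proof. by case: fr => _ BD _ _; rewrite row_lattice_pt pairing_row BD mxE. Qed.

Lemma frame_expand x : x = \sum_i pairing x (col i D) *: lat (row i B).
Proof.
case: fr => _ BD _ _; rewrite -[LHS]mulmx1 -(mulmx1C BD) mulmxA mulmx_sum_row.
apply: eq_bigr => i _; rewrite row_lattice_pt; congr (_ *: _).
by rewrite /pairing !mxE; apply: eq_bigr => k _; rewrite !mxE.
Qed.

Lemma frame_pairing x u :
  pairing x u = \sum_i pairing x (col i D) * pairing (lat (row i B)) u.
Proof.
rewrite {1}(frame_expand x) pairing_suml; apply: eq_bigr => i _.
by rewrite pairingZl.
Qed.

Lemma frame_row_neq0 i : row i B != 0.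
Proof.
apply/eqP => E; have := frame_dual i i; rewrite E lattice_pt0 pairing0l eqxx.
by move/eqP; rewrite eq_sym oner_eq0.
Qed.

Lemma frame_coord_inj x : (forall i, pairing x (col i D) = 0) -> x = 0.
Proof.
by move=> H; rewrite (frame_expand x) big1 // => i _; rewrite H scale0r.
Qed.

Lemma frame_row_inj : injective (fun i => row i B).
Proof.
move=> i j /= E; have := frame_dual i j; rewrite E frame_dual eqxx.
by case: eqP => // _ /eqP; rewrite oner_eq0.
Qed.

Lemma face_cone_le u x : face_cone B pred0 u -> P x ->
  pairing x u <= pairing (lat y) u.
Proof.
move=> Hu Px; rewrite -subr_le0 -pairingBl frame_pairing; apply: sumr_le0 => i _.
by apply: mulr_ge0_le0; [case: fr => _ _ H _; apply: H|case: (Hu i)].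
Qed.

Lemma face_cone_pred0 J : face_cone B J `<=` face_cone B pred0.
Proof. by move=> u Hu i; split=> //; case: (Hu i). Qed.

Lemma face_cone_eq J u x : face_cone B J u ->
  (forall i, ~~ J i -> pairing (x - lat y) (col i D) = 0) ->
  pairing x u = pairing (lat y) u.
Proof.
move=> Hu Hx; apply/eqP; rewrite -subr_eq0 -pairingBl frame_pairing big1 // => i _.
by have [/(Hu i).2->|/Hx->] := boolP (J i); rewrite ?mulr0 ?mul0r.
Qed.

(** These vectors are the ray generators of the cone; characters are tested on them below. *)
Lemma face_cone_dual J i : ~~ J i -> face_cone B J (- col i D).
Proof.
move=> Ji j; rewrite pairingNr frame_dual oppr_le0 ler0n; split=> // Jj.
by case: eqP => [E|_]; rewrite ?oppr0 //; rewrite E (negbTE Ji) in Jj.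
Qed.

Lemma vertex_normal_cone : outer_normal_cone P [set lat y] = face_cone B pred0.
Proof.
case: fr => Py _ _ Hrow; apply/seteqP; split => u Hu.
  move=> i; split=> //; have [c c0 Pc] := Hrow i.
  have := Hu _ _ (erefl : [set lat y] (lat y)) Pc.
  by rewrite pairingDl pairingZl gerDl pmulr_rle0.
by move=> _ x -> Px; apply: face_cone_le.
Qed.

Lemma frame_face J : exists F, [/\ face P F, F (lat y),
    outer_normal_cone P F = face_cone B J &
    F = [set x | P x /\ forall i, ~~ J i -> pairing (x - lat y) (col i D) = 0]].
Proof.
case: fr => Py _ Hpos Hrow.
(* Minus the sum of the facet normals off [J]: on [P] it is maximal exactly where all these
   coordinates vanish. *)
pose w : 'cV[R]_n := - \sum_(i | ~~ J i) col i D.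
have wE x : P x -> (forall z, P z -> pairing z w <= pairing x w) <->
    forall i, ~~ J i -> pairing (x - lat y) (col i D) = 0.
  move=> Px.
  have E z : pairing z w - pairing (lat y) w =
      - \sum_(i | ~~ J i) pairing (z - lat y) (col i D).
    by rewrite -pairingBl pairingNr pairing_sumr.
  split=> [/(_ _ Py)|H z Pz].
    rewrite -subr_ge0 E oppr_ge0 => le0; apply/psumr_eq0P; first by move=> i _; exact: Hpos.
    by apply/eqP; rewrite eq_le le0 sumr_ge0 // => i _; exact: Hpos.
  rewrite -(lerD2r (- pairing (lat y) w)) !E lerN2 big1 // sumr_ge0 // => i _.
  exact: Hpos.
pose F := [set x | P x /\ forall z, P z -> pairing z w <= pairing x w].
have FE : F = [set x | P x /\ forall i, ~~ J i -> pairing (x - lat y) (col i D) = 0].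
  by apply/seteqP; split=> x [Px H]; split=> //; apply/(wE _ Px).
have Fy : F (lat y) by rewrite FE; split=> // i _; rewrite subrr pairing0l.
exists F; split=> //; first by split; [exists (lat y)|exists w].
apply/seteqP; split=> u Hu.
  move=> i; have [c c0 Pc] := Hrow i; split.
    by have := Hu _ _ Fy Pc; rewrite pairingDl pairingZl gerDl pmulr_rle0.
  move=> Ji; have Fc : F (lat y + c *: lat (row i B)).
    rewrite FE; split=> // j Jj; rewrite addrC addKr pairingZl frame_dual.
    by case: eqP => [E|_]; rewrite ?mulr0 //; rewrite -E Ji in Jj.
  apply/eqP; rewrite eq_le; apply/andP; split.
    by have := Hu _ _ Fy Pc; rewrite pairingDl pairingZl gerDl pmulr_rle0.
  by have := Hu _ _ Fc Py; rewrite pairingDl pairingZl lerDl pmulr_rge0.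
move=> x z; rewrite FE => -[_ Hx] Pz; rewrite (face_cone_eq Hu Hx).
exact: face_cone_le (face_cone_pred0 Hu) Pz.
Qed.

Lemma face_cone_fan J : outer_normal_fan P (face_cone B J).
Proof. by have [F [fF _ <- _]] := frame_face J; exists F. Qed.

Lemma orthogonal_face_cone J m i : orthogonal_lattice (face_cone B J) m ->
  ~~ J i -> pairing (lat m) (col i D) = 0.
Proof.
by move=> H /face_cone_dual/H; rewrite pairingNr => /eqP; rewrite oppr_eq0 => /eqP.
Qed.

Lemma dual_face_cone J m i : dual_cone (face_cone B J) m ->
  ~~ J i -> pairing (lat m) (col i D) <= 0.
Proof. by move=> H /face_cone_dual/H; rewrite pairingNr oppr_ge0. Qed.

Lemma orthogonal_vertex_cone m :
  orthogonal_lattice (outer_normal_cone P [set lat y]) m -> m = 0.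
Proof.
rewrite vertex_normal_cone => H; apply: (@lattice_pt_inj R).
by rewrite lattice_pt0; apply: frame_coord_inj => i; apply: (orthogonal_face_cone H).
Qed.

(* The adjugate makes the interior vector of the normal cone integral. *)
Lemma interior_cocharacter : exists w : 'cV[int]_n,
  forall i, pairing (row i B) w < 0.
Proof.
exists (- (\det B *: (\adj B *m const_mx 1))) => i.
have -> : pairing (row i B) (- (\det B *: (\adj B *m const_mx 1))) = - (\det B ^+ 2).
  rewrite pairingNr pairingZr /pairing mulmxA -row_mul mul_mx_adj -row_mul.
  by rewrite mul_scalar_mx !mxE mulr1 expr2.
rewrite oppr_lt0 lt_def sqr_ge0 sqrf_eq0 andbT; case: fr => _ BD _ _.
apply/eqP => B0; have := congr1 determinant BD.
by rewrite det_mulmx det_map_mx B0 mul0r det1 => /esym/eqP; rewrite oner_eq0.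
Qed.

End OneFrame.
End Frames.

(** * Fixed points, plus cells and the triangle argument *)

Section ToricPolytope.
Variables (R : realType) (K : closedFieldType) (n : nat).
Local Notation lat := (@lattice_pt R n).
Variables (P : set 'rV[R]_n) (V : set 'rV[int]_n).
(** [V] stands for the vertex set. The toric argument draws on the shape of [P] only through these
    two facts, which are later established for the truncation. *)
Hypothesis V_frame : forall y, V y -> exists B D, frame P y B D.
Hypothesis V_face : forall F, face P F -> exists2 y, V y & F (lat y).

Local Notation Sigma := (outer_normal_fan P).
Local Notation vcone y := (outer_normal_cone P [set lat y]).
Local Notation X := (@toric_variety R K n Sigma).
Local Notation pt := (@distinguished_pt R K n).
Implicit Types (x : Defs.point R K n) (y a b c w m : 'rV[int]_n) (v : 'cV[int]_n) (J : pred 'I_n).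

Lemma vconeP y u :
  vcone y u <-> forall x : 'rV[R]_n, P x -> pairing x u <= pairing (lat y) u.
Proof. by split=> [H x Px|H _ x ->]; [apply: H|apply: H]. Qed.

Lemma V_mem y : V y -> P (lat y).
Proof. by move=> /V_frame[B [D []]]. Qed.

Lemma fan_vertex_subset sigma : Sigma sigma -> exists2 y, V y & sigma `<=` vcone y.
Proof.
move=> [F fF <-]; have [y Vy Fy] := V_face fF; exists y => // u Hu.
by apply/vconeP => x; apply: Hu.
Qed.

Lemma vcone_fan y : V y -> Sigma (vcone y).
Proof.
by move=> /V_frame[B [D fr]]; rewrite (vertex_normal_cone fr); apply: face_cone_fan fr _.
Qed.

(** Both vertices maximize every functional in [sigma]. With the converse below, chi^(w - y) is
    nonzero on the chart at [w] exactly at the points of the chart at [y]. *)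
Lemma vcone_orthogonal sigma y w : V y -> V w ->
  sigma `<=` vcone y -> sigma `<=` vcone w -> orthogonal_lattice sigma (w - y).
Proof.
move=> Vy Vw sy sw u su; rewrite lattice_ptB pairingBl; apply/eqP.
rewrite subr_eq0 eq_le; apply/andP; split.
  by apply: (vconeP y u).1; [exact: sy|exact: V_mem].
by apply: (vconeP w u).1; [exact: sw|exact: V_mem].
Qed.

Lemma orthogonal_vcone sigma y w : sigma `<=` vcone w ->
  orthogonal_lattice sigma (w - y) -> sigma `<=` vcone y.
Proof.
move=> sw o u su; apply/vconeP => x Px.
have /eqP := o u su; rewrite lattice_ptB pairingBl subr_eq0 => /eqP <-.
by move: x Px; apply/vconeP; apply: sw.
Qed.

Lemma vcone_dual y w : V y -> dual_cone (vcone w) (w - y).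
Proof.
move=> Vy u /vconeP H; rewrite lattice_ptB pairingBl subr_ge0; apply: H.
exact: V_mem.
Qed.

Lemma dual_coneD (sigma : set 'cV[R]_n) m m' :
  dual_cone sigma m -> dual_cone sigma m' -> dual_cone sigma (m + m').
Proof. by move=> d d' u su; rewrite lattice_ptD pairingDl addr_ge0 ?d ?d'. Qed.

Lemma dual_coneMn (sigma : set 'cV[R]_n) m k :
  dual_cone sigma m -> dual_cone sigma (m *+ k).
Proof. by move=> d u su; rewrite lattice_ptMn pairingMnl mulrn_wge0 ?d. Qed.

Lemma dual_coneS (sigma tau : set 'cV[R]_n) m :
  tau `<=` sigma -> dual_cone sigma m -> dual_cone tau m.
Proof. by move=> st d u /st/d. Qed.

Lemma orthogonalMn (sigma : set 'cV[R]_n) m k :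
  orthogonal_lattice sigma m -> orthogonal_lattice sigma (m *+ k).
Proof. by move=> d u su; rewrite lattice_ptMn pairingMnl d // mul0rn. Qed.

Lemma orthogonalD (sigma : set 'cV[R]_n) m m' :
  orthogonal_lattice sigma m -> orthogonal_lattice sigma m' ->
  orthogonal_lattice sigma (m + m').
Proof. by move=> o o' u su; rewrite lattice_ptD pairingDl o // o' // addr0. Qed.

(** The zero locus of the homogeneous coordinate of [y], which reads chi^(w - y) in the chart at
    [w]. *)
Lemma closed_not_vcone y : V y ->
  zariski_closed Sigma [set x | X x /\ ~ (x.1 `<=` vcone y)].
Proof.
move=> Vy; split=> [x []//|sigma Ss].
have [w Vw sw] := fan_vertex_subset Ss.
exists [set [:: (1 : K, w - y)]]; split.
  by move=> _ -> t; rewrite inE => /eqP -> /=; apply: dual_coneS sw _; exact: vcone_dual.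
move=> x [Xx xs]; have xw := subset_trans xs sw.
have [_ _ _ /(_ (w - y)) Hx] := Xx.
have E : eval_function [:: (1, w - y)] x = x.2 (w - y).
  by rewrite /eval_function big_seq1 mul1r.
split=> [[_ ny] _ ->|/(_ _ (erefl _))].
  by rewrite E; apply: toric_eq0 Xx _ => o; apply: ny; apply: orthogonal_vcone xw o.
rewrite E => /eqP x0; split=> // xy; move: x0; apply/negP/Hx.
exact: vcone_orthogonal.
Qed.

(** The homogeneous equation X_a^i X_c^j = X_b^(i+j), dehomogenized in every vertex chart containing
    the point. *)
Definition binomial_set a b c (i j : nat) : set (Defs.point R K n) :=
  [set x | X x /\ forall w, V w -> x.1 `<=` vcone w ->
     x.2 ((w - a) *+ i + (w - c) *+ j) = x.2 ((w - b) *+ (i + j))].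

(** Passing from [w] to another vertex w' whose chart contains the point multiplies both sides by
    the value of chi^((i+j)(w' - w)), so the equation at one [w] implies the others. *)
Lemma closed_binomial a b c i j : V a -> V b -> V c ->
  zariski_closed Sigma (binomial_set a b c i j).
Proof.
move=> Va Vb Vc; split=> [x []//|sigma Ss].
have [w Vw sw] := fan_vertex_subset Ss.
pose m1 w := (w - a) *+ i + (w - c) *+ j.
pose m2 w := (w - b) *+ (i + j).
have d1 : dual_cone (vcone w) (m1 w).
  by apply: dual_coneD; apply: dual_coneMn; apply: vcone_dual.
have d2 : dual_cone (vcone w) (m2 w) by apply: dual_coneMn; apply: vcone_dual.
exists [set [:: (1 : K, m1 w); (-1, m2 w)]]; split.
  move=> _ -> t; rewrite !inE => /orP[] /eqP -> /=; exact: dual_coneS sw _.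
move=> x [Xx xs]; have xw := subset_trans xs sw.
have E : eval_function [:: (1, m1 w); (-1, m2 w)] x = x.2 (m1 w) - x.2 (m2 w).
  by rewrite /eval_function big_cons big_seq1 mul1r mulN1r.
split=> [[_ Hx] _ ->|/(_ _ (erefl _))]; first by rewrite E Hx // subrr.
rewrite E => /eqP; rewrite subr_eq0 => /eqP Ew; split=> // w' Vw' xw'.
have o : orthogonal_lattice x.1 ((w' - w) *+ (i + j)).
  by apply: orthogonalMn; apply: vcone_orthogonal.
have [_ _ xD _] := Xx.
have Eb z k : (w' - z) *+ k = (w - z) *+ k + (w' - w) *+ k :> 'rV[int]_n.
  by rewrite -mulrnDl addrC subrKA.
have -> : (w' - a) *+ i + (w' - c) *+ j = m1 w + (w' - w) *+ (i + j).
  by rewrite /m1 (Eb a) (Eb c) mulrnDr addrACA.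
have -> : (w' - b) *+ (i + j) = m2 w + (w' - w) *+ (i + j) by rewrite Eb.
have od := orthogonal_dual o.
have s1 := dual_coneS xw d1; have s2 := dual_coneS xw d2.
by rewrite (xD _ _ s1 od) (xD _ _ s2 od) Ew.
Qed.

(** A point of the face of [x] other than [y] would have a nonzero coordinate at [y]; the
    corresponding edge direction would be orthogonal to [x.1], which a T-fixed point forbids. *)
Lemma T_fixed_vertex x y : T_fixed X x -> V y -> x.1 `<=` vcone y -> x = pt (vcone y).
Proof.
move=> Tx Vy xy; have [B [D fr]] := V_frame Vy.
have [Xx _] := Tx; have [[F fF FE] x20 _ _] := Xx.
have x1 : x.1 = vcone y.
  have [[z Fz] [u0 u0E]] := fF.
  suff Fy (r : 'rV[R]_n) : F r -> r = lat y.
    by rewrite -FE; congr outer_normal_cone; apply/seteqP; split=> [r /Fy //|_ ->];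
      rewrite -(Fy z Fz).
  move=> Fr; have Pr : P r by move: Fr; rewrite u0E => -[].
  apply/eqP; rewrite -subr_eq0; apply/eqP/(frame_coord_inj fr) => i.
  apply/eqP; apply: contraT => ci.
  have o : orthogonal_lattice x.1 (row i B).
    move=> u xu; have cu := xy u xu; move: (cu).
    rewrite (vertex_normal_cone fr) => fu.
    have E : \sum_j pairing (r - lat y) (col j D) * - pairing (lat (row j B)) u = 0.
      rewrite (eq_bigr (fun j => - (pairing (r - lat y) (col j D) *
                 pairing (lat (row j B)) u))); last by move=> j _; rewrite mulrN.
      rewrite sumrN -(frame_pairing fr) pairingBl; apply/eqP.
      rewrite oppr_eq0 subr_eq0 eq_le; apply/andP; split.
        exact: (vconeP y u).1.
      by move: xu; rewrite -FE => /(_ r (lat y) Fr); apply; exact: V_mem.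
    have /psumr_eq0P : forall j : 'I_n, true -> 0 <=
        pairing (r - lat y) (col j D) * - pairing (lat (row j B)) u.
      move=> j _; rewrite mulr_ge0 // ?oppr_ge0; last by case: (fu j).
      by case: fr => _ _ H _; apply: H.
    move=> /(_ E i isT)/eqP; rewrite mulf_eq0 (negbTE ci) /= oppr_eq0.
    by move=> /eqP.
  by have := frame_row_neq0 fr i; rewrite (T_fixed_orthogonal Tx o) eqxx.
rewrite [x]surjective_pairing {1}x1; congr (_, _); apply/funext => m.
case: asboolP => o; last by apply: toric_eq0 Xx _; rewrite x1.
by rewrite (orthogonal_vertex_cone fr o).
Qed.

Lemma frame_pairing_gt0 y B D v m : frame P y B D ->
  (forall i, pairing (lat m) (col i D) <= 0) ->
  (forall i, pairing (lat m) (col i D) != 0 -> pairing (row i B) v < 0) ->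
  m != 0 -> 0 < pairing m v.
Proof.
move=> fr mle mv m0; rewrite -(ltr0z R) -pairing_lattice (frame_pairing fr).
have ge0 (i : 'I_n) : true -> 0 <= pairing (lat m) (col i D) *
    pairing (lat (row i B)) (map_mx intr v).
  move=> _; have [->|/mv] := eqVneq (pairing (lat m) (col i D)) 0.
    by rewrite mul0r.
  by rewrite pairing_lattice => lt; apply: mulr_le0 => //; rewrite lerz0 ltW.
rewrite lt_def sumr_ge0 ?andbT //; apply: contraNneq m0 => S0.
apply/eqP/(@lattice_pt_inj R); rewrite lattice_pt0; apply: (frame_coord_inj fr) => i.
apply/eqP; apply: contraT => mi; have := psumr_eq0P ge0 S0 (i := i) isT.
move=> /eqP; rewrite mulf_eq0 (negbTE mi) pairing_lattice intr_eq0 /= => /eqP v0.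
by have := mv i mi; rewrite v0 ltxx.
Qed.

(** A character regular at [y] and nonzero at [x] is constant or has positive weight, so its
    pullback is a polynomial with the right value at 0; the other characters pull back to 0. *)
Lemma limit_vertex y v x : V y -> X x -> x.1 `<=` vcone y ->
  (forall m, orthogonal_lattice x.1 m -> dual_cone (vcone y) m -> m != 0 ->
     0 < pairing m v) ->
  limit_at_0 Sigma v x (pt (vcone y)).
Proof.
move=> Vy Xx xy Hv; have [B [D fr]] := V_frame Vy.
have Sy := vcone_fan Vy; exists (vcone y); split=> //.
  by split=> //; apply: distinguished_toric.
move=> m dm; have [->|m0] := eqVneq m 0.
  exists 1; rewrite hornerC distinguished_orthogonal //; last exact: orthogonal0.
  split=> // t t0; rewrite hornerC.
  by have [_ -> _ _] := toric_Gm_act v t0 Xx.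
have p0 : (pt (vcone y)).2 m = 0.
  apply: distinguished_not_orthogonal => /(orthogonal_vertex_cone fr) E.
  by rewrite E eqxx in m0.
have [o|no] := EM (orthogonal_lattice x.1 m); last first.
  exists 0; rewrite p0 horner0; split=> // t t0.
  by rewrite horner0 /= (toric_eq0 Xx no) mulr0.
have := Hv m o dm m0; case E: (pairing m v) => [k|//] k0.
exists (x.2 m *: 'X^k); rewrite p0; split=> [t t0|].
  by rewrite hornerZ hornerXn /= /cocharacter E mulrC.
by case: k k0 {E} => // k _; rewrite hornerZ hornerXn expr0n mulr0.
Qed.

Lemma plus_cell_face y B D J v (s : 'rV[int]_n -> K) : V y -> frame P y B D ->
  (forall i, J i -> pairing (row i B) v < 0) -> torus s ->
  plus_cell Sigma v (pt (vcone y)) (torus_act s (pt (face_cone B J))).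
Proof.
move=> Vy fr Jv Ts.
have Xs : X (torus_act s (pt (face_cone B J))).
  by apply: toric_act Ts _; apply: distinguished_toric; apply: face_cone_fan fr _.
split=> //; apply: limit_vertex => //.
  by rewrite (vertex_normal_cone fr); apply: face_cone_pred0.
move=> m o dm; apply: (frame_pairing_gt0 fr) => i.
  by apply: (@dual_face_cone _ _ _ _ _ _ fr pred0) => //; rewrite -(vertex_normal_cone fr).
move=> mi; apply: Jv; apply: contraR mi => Ji.
by apply/eqP; apply: (orthogonal_face_cone fr o).
Qed.

(** The orbit of the face lies in the plus cell. A second one-parameter subgroup [l], interior to
    the normal cone at [a] and unrelated to [v], moves its unit point to the fixed point of [a]. *)
Lemma plus_cell_closure_vertex y B D J v a : V y -> frame P y B D ->
  (forall i, J i -> pairing (row i B) v < 0) -> V a -> face_cone B J `<=` vcone a ->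
  zariski_closure Sigma (plus_cell Sigma v (pt (vcone y))) (pt (vcone a)).
Proof.
move=> Vy fr Jv Va sub C HC HY; have [B' [D' fr']] := V_frame Va.
have [l Hl] := interior_cocharacter fr'.
apply: (@limit_closed _ _ _ Sigma l (pt (face_cone B J))) => // [t t0|].
  by apply: HY; apply: plus_cell_face fr Jv _ => //; apply: torus_cocharacter.
apply: limit_vertex => //; first by apply: distinguished_toric; apply: face_cone_fan fr _.
move=> m _ dm; apply: (frame_pairing_gt0 fr') => i //.
by apply: (@dual_face_cone _ _ _ _ _ _ fr' pred0) => //; rewrite -(vertex_normal_cone fr').
Qed.

(** If [x] were in the charts at both [y] and [b], the edge direction [i] would be orthogonal to
    [x.1]. The character of its negative, regular at [y], would then be nonzero at [x] with negative
    weight, giving a pole at t = 0. *)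
Lemma plus_cell_not_vcone y B D i v b : V y -> frame P y B D ->
  0 < pairing (row i B) v -> V b -> pairing (lat b - lat y) (col i D) != 0 ->
  plus_cell Sigma v (pt (vcone y)) `<=` [set x | X x /\ ~ (x.1 `<=` vcone b)].
Proof.
move=> Vy fr iv Vb bi x [Xx [sigma [Ss [_ xs] [_ /= ys] Hlim]]]; split=> // xb.
(* The chart in which the limit is taken may be assumed to be the one at [y]: [sigma] contains the
   normal cone of [y], hence a functional maximal only at [y], so its face is [y] alone. *)
have sy : sigma `<=` vcone y.
  move: Ss ys => [F [[z Fz] [u0 u0E]] <-] ys.
  have Pz : P z by move: Fz; rewrite u0E => -[].
  suff <- : z = lat y by move=> u Hu _ z' -> Pz'; apply: Hu.
  have fc : face_cone B pred0 (- \sum_j col j D).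
    move=> j; split=> //; rewrite pairingNr oppr_le0 pairing_sumr sumr_ge0 // => k _.
    by rewrite (frame_dual fr) ler0n.
  rewrite -(vertex_normal_cone fr) in fc.
  have := ys _ fc z (lat y) Fz (V_mem Vy).
  have ge0 (j : 'I_n) : true -> 0 <= pairing (z - lat y) (col j D).
    by move=> _; case: fr => _ _ H _; apply: H.
  rewrite -subr_ge0 -pairingBl pairingNr pairing_sumr oppr_ge0 => le0.
  have S0 : \sum_j pairing (z - lat y) (col j D) = 0.
    by apply/eqP; rewrite eq_le le0 sumr_ge0.
  apply/eqP; rewrite -subr_eq0; apply/eqP/(frame_coord_inj fr) => j.
  exact: (psumr_eq0P ge0 S0).
have dm : dual_cone sigma (- row i B).
  move=> u /sy; rewrite (vertex_normal_cone fr) => /(_ i)[le0 _].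
  by rewrite lattice_ptN pairingNl oppr_ge0.
have om : orthogonal_lattice x.1 (- row i B).
  move=> u xu; rewrite lattice_ptN pairingNl.
  have := sy u (xs u xu); rewrite (vertex_normal_cone fr) => fu.
  have /eqP := vcone_orthogonal Vy Vb (subset_trans xs sy) xb xu.
  rewrite lattice_ptB (frame_pairing fr) -oppr_eq0 -sumrN => /eqP E.
  have /psumr_eq0P : forall j : 'I_n, true -> 0 <=
     - (pairing (lat b - lat y) (col j D) * pairing (lat (row j B)) u).
    move=> j _; rewrite -mulrN mulr_ge0 // ?oppr_ge0; last by case: (fu j).
    by case: fr => _ _ H _; apply: H; exact: V_mem.
  move=> /(_ E i isT)/eqP; rewrite oppr_eq0 mulf_eq0 (negbTE bi) /= => /eqP ->.
  by rewrite oppr0.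
have [f [f1 _]] := Hlim _ dm; have x0 : x.2 (- row i B) != 0.
  by have [_ _ _ H] := Xx; apply/H.
case E: (pairing (row i B) v) iv => [k|//] k0.
have : f * 'X^k - (x.2 (- row i B))%:P = 0.
  apply: poly_eq0_off0 => t t0; rewrite hornerD hornerM hornerN hornerC hornerXn f1 //.
  rewrite /= /cocharacter pairingNl E -exprnN mulrAC mulVf ?mul1r ?subrr //.
  by rewrite expf_neq0.
move=> /(congr1 (fun q => q.[0])); rewrite hornerD hornerM hornerN !hornerC hornerXn.
rewrite expr0n; case: k k0 {E} => // k _; rewrite mulr0 sub0r => /eqP.
by rewrite oppr_eq0 (negbTE x0).
Qed.

(** If [v] were constant on the edge, the unit point of the edge's orbit would be fixed by G_m but
    not by T. *)
Lemma admissible_edge y B D v i : admissible K Sigma v -> frame P y B D ->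
  pairing (row i B) v != 0.
Proof.
move=> adm fr; apply/eqP => v0.
have Xp : X (pt (face_cone B (pred1 i))).
  by apply: distinguished_toric; apply: face_cone_fan fr _.
have : Gm_fixed v X (pt (face_cone B (pred1 i))).
  split=> // t t0; congr (_, _); apply/funext => m /=.
  case: asboolP => o; last by rewrite mulr0.
  suff -> : cocharacter v t m = 1 by rewrite mulr1.
  suff mv : pairing m v = 0 by rewrite /cocharacter mv expr0z.
  apply/eqP; rewrite -(intr_eq0 R) -pairing_lattice (frame_pairing fr).
  rewrite big1 // => j _; have [->|ji] := eqVneq j i.
    by rewrite pairing_lattice v0 mulr0.
  by rewrite (orthogonal_face_cone fr o) ?mul0r.
rewrite adm => /T_fixed_orthogonal/(_ (_ : orthogonal_lattice _ (row i B))) E.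
have := frame_row_neq0 fr i; rewrite E ?eqxx // => u /(_ i)[_]; apply.
exact: eqxx.
Qed.

(* The one-parameter orbit closure of the distinguished point of the triangle
   abc has a and c as its only fixed points; they lie in the closure of the
   plus cell of y, but the orbit itself does not. *)
Lemma triangle_not_well_rounded v y B D i b Bb Db j ja jc a c :
  admissible K Sigma v ->
  V y -> frame P y B D ->
  (forall k, k != i -> pairing (row k B) v < 0) -> 0 < pairing (row i B) v ->
  V b -> frame P b Bb Db -> ja != j -> jc != j ->
  V a -> a = b + row ja Bb -> pairing (row ja Bb) v < 0 ->
  V c -> c = b + row jc Bb -> 0 < pairing (row jc Bb) v ->
  (forall w, V w -> face_cone Bb (predC1 j) `<=` vcone w -> w \in [:: a; b; c]) ->
  pairing (lat a - lat y) (col i D) = 0 -> pairing (lat c - lat y) (col i D) = 0 ->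
  pairing (lat b - lat y) (col i D) != 0 ->
  ~ well_rounded K Sigma v.
Proof.
move=> adm Vy fr vneg vpos Vb frb jaj jcj Va aE va Vc cE vc tri ai ci bi wr.
set p := pt (vcone y).
set fq := @face_cone R n Bb (predC1 j); set q := pt fq.
have Xq : X q by apply: distinguished_toric; apply: face_cone_fan frb _.
have Xp : X p by apply: distinguished_toric; apply: vcone_fan.
have fp : Gm_fixed v X p.
  split=> // t t0; congr (_, _); apply/funext => m /=.
  case: asboolP => o; last by rewrite mulr0.
  by rewrite (orthogonal_vertex_cone fr o) /cocharacter pairing0l expr0z mulr1.
have [_ conv] := wr p fp.
have inY e : V e -> pairing (lat e - lat y) (col i D) = 0 ->
    zariski_closure Sigma (plus_cell Sigma v p) (pt (vcone e)).
  move=> Ve ei; apply: (plus_cell_closure_vertex (J := predC1 i) Vy fr) => //.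
  move=> u Hu; apply/vconeP => x Px; rewrite (@face_cone_eq _ _ _ _ _ _ fr _ _ (lat e) Hu).
    exact: (face_cone_le fr (face_cone_pred0 Hu)).
  by move=> k; rewrite /= negbK => /eqP ->.
have qb : fq `<=` vcone b.
  by rewrite (vertex_normal_cone frb); apply: face_cone_pred0.
have orow k : k != j -> orthogonal_lattice fq (row k Bb).
  by move=> kj u /(_ k)[_]; apply.
have subZ C : zariski_closed Sigma C -> (forall t, t != 0 -> C (Gm_act v t q)) ->
    zariski_closure Sigma (Gm_orbit v q) `<=` C.
  by move=> HC H; apply: closure_min => // _ [t t0 ->]; apply: H.
have := (conv _ (Gm_orbit_closure_subvariety v Xq)).2.
have sub : Gm_fixed v (zariski_closure Sigma (Gm_orbit v q)) `<=`
    Gm_fixed v (zariski_closure Sigma (plus_cell Sigma v p)).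
  move=> x [Zx fx]; split=> //.
  have Xx : X x by apply: subZ Zx; [exact: toric_closed|move=> t t0; exact: toric_Gm_act].
  have Tx : T_fixed X x by rewrite -adm.
  have [w Vw xw] : exists2 w, V w & x.1 `<=` vcone w.
    by apply: fan_vertex_subset; case: Xx.
  have xE := T_fixed_vertex Tx Vw xw.
  have : w \in [:: a; b; c].
    (* If [w] were not on the triangle, the orbit of [q] and hence [x] would lie in the closed
       complement of the chart at [w]. *)
    apply: tri => //; apply: contrapT => nw.
    have /= [] := subZ _ (closed_not_vcone Vw) _ _ Zx.
      by move=> t t0; split=> //; exact: toric_Gm_act.
    by move=> _; apply.
  rewrite !inE => /or3P[] /eqP wE; rewrite xE wE; [exact: inY| |exact: inY].
  exfalso; move: va vc; case Ea: (pairing (row ja Bb) v) => [//|d] _.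
  case Ec: (pairing (row jc Bb) v) => [e|//] _.
  (* With v(a) - v(b) = -(d+1) and v(c) - v(b) = e, these exponents give both sides of the binomial
     equal weights, and both are 1 at [q]. *)
  pose C := binomial_set a b c e d.+1.
  have HC : zariski_closed Sigma C by apply: closed_binomial.
  have [_ /(_ w Vw xw)] : C x.
    apply: (subZ C HC) Zx => t t0; split; first exact: toric_Gm_act.
    move=> z Vz qz /=.
    have ob : orthogonal_lattice fq (z - b).
      exact: vcone_orthogonal.
    have oe k : k != j -> orthogonal_lattice fq (z - (b + row k Bb)).
      by move=> kj u Hu; rewrite opprD addrA lattice_ptB pairingBl ob // orow // subrr.
    have o1 : orthogonal_lattice fq ((z - a) *+ e + (z - c) *+ d.+1).
      by apply: orthogonalD; rewrite ?aE ?cE; apply: orthogonalMn; apply: oe.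
    have o2 := orthogonalMn (e + d.+1) ob.
    rewrite !asboolT // !mulr1; congr (_ ^ _).
    rewrite pairingDl !pairingMnl !pairingBl aE cE !pairingDl Ea Ec NegzE.
    rewrite !pmulrn !mulrzz PoszD; move: (pairing z v) (pairing b v) (Posz e) (Posz d.+1).
    by move=> *; ring.
  (* At the fixed point of [b] the right side is 1. The left side is nonzero only if its exponent is
     0, but the [jc] coordinate of that exponent is negative. *)
  rewrite xE wE /= subrr mul0rn (asboolT (@orthogonal0 R n (vcone b))).
  case: asboolP => [/(orthogonal_vertex_cone frb) E _|_ /eqP]; last by rewrite eq_sym oner_eq0.
  have := congr1 (fun m => pairing (lat m) (col jc Db)) E.
  rewrite /= lattice_ptD !lattice_ptMn !lattice_ptB lattice_pt0 pairingDl !pairingMnl.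
  rewrite aE cE !lattice_ptD !pairingBl !pairingDl !(frame_dual frb) pairing0l eqxx.
  rewrite !opprD !addrA !subrr !sub0r mulNrn.
  have := ler0n R ((ja == jc) * e); have := ltr0Sn R d.
  rewrite natrM mulr_natr -[(-1) *+ _]mulr_natr; lra.
move=> /(_ sub) ZY.
have : zariski_closure Sigma (plus_cell Sigma v p) q.
  by apply: ZY; apply: closure_subset; exists 1; rewrite ?oner_neq0 ?Gm_act1.
move=> /(closure_min (closed_not_vcone Vb) (plus_cell_not_vcone Vy fr vpos Vb bi)).
by case=> _; apply.
Qed.

End ToricPolytope.

(** * Tangent cones and edges at a smooth vertex *)

Section SmoothVertex.
Variables (R : realType) (n : nat) (s : seq 'rV[int]_n).
Local Notation lat := (@lattice_pt R n).
Local Notation Q := (@convex_hull R n s).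
Implicit Types (x : 'rV[R]_n) (u : 'cV[R]_n) (m e : 'rV[int]_n).

(** Take the largest [k] dividing [m]; any nonzero entry of [m] bounds it. *)
Lemma primitive_part m : m != 0 -> exists e k,
  [/\ (0 < k)%N, m = e *+ k & primitive e].
Proof.
move=> m0; have [j mj] : exists j, m ord0 j != 0.
  apply: contrapT => /forallNP H; move/eqP: m0; apply; apply/rowP => j.
  by rewrite mxE; apply/eqP; apply: contraT => /(H j).
pose p (k : nat) := `[< exists e, m = e *+ k >].
have p1 : exists k, p k by exists 1%N; apply/asboolP; exists m.
have pb k : p k -> (k <= absz (m ord0 j))%N.
  move=> /asboolP[e E]; move: mj; rewrite E mulmxnE -mulr_natr natz.
  rewrite mulf_eq0 negb_or => /andP[ej _]; rewrite abszM absz_nat leq_pmull //.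
  by rewrite absz_gt0.
case: (ex_maxnP p1 pb) => k /asboolP[e mE] kmax.
exists e, k; split=> //.
  by rewrite lt0n; apply: contraNneq m0 => k0; rewrite mE k0 mulr0n.
move=> e' k' eE; have k'1 : (k' <= 1)%N.
  have k0 : (0 < k)%N.
    by rewrite lt0n; apply: contraNneq m0 => k0; rewrite mE k0 mulr0n.
  rewrite -(leq_pmul2r k0) mul1n; apply: kmax; apply/asboolP; exists e'.
  by rewrite mE eE mulrnA.
case: k' k'1 eE => [|[|//]] // _ e0; move: m0; rewrite mE e0 mulr0n mul0rn eqxx.
by [].
Qed.

Lemma primitiveN e : primitive e -> primitive (- e).
Proof. by move=> H e' k E; apply: (H (- e')); rewrite mulNrn -E opprK. Qed.

Section AtVertex.
Variables (z : 'rV[int]_n) (B : 'M[int]_n).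
Hypothesis vz : vertex Q (lat z).
Hypothesis Bunit : B \in unitmx.
Hypothesis edges : forall e, edge_direction Q (lat z) e <-> exists i, e = row i B.

Local Notation D := (map_mx intr (invmx B) : 'M[R]_n).

Lemma smooth_dual_basis : map_mx intr B *m D = 1%:M.
Proof. by rewrite -map_mxM mulmxV // map_mx1. Qed.

Lemma smooth_dual i j : pairing (lat (row i B)) (col j D) = (i == j)%:R.
Proof. by rewrite row_lattice_pt pairing_row smooth_dual_basis mxE. Qed.

(* Rescaling the generators of the tangent cone to a hyperplane section, the
   maximizer of a functional there may be taken exposed; it then spans an edge. *)
Lemma smooth_tangent_cone m i : m \in s ->
  0 <= pairing (lat m - lat z) (col i D).
Proof.
move=> ms; rewrite leNgt; apply/negP => neg.
have [_ [u0 u0E]] := vz.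
have : [set lat z] (lat z) by [].
rewrite [in X in X -> _]u0E => -[Qz zmax].
(* The drop of the exposing functional below its value at [z]; dividing by it puts all directions
   from [z] on one hyperplane. *)
pose tau m : R := pairing (lat z - lat m) u0.
have tau_gt0 m' : m' \in s -> m' != z -> 0 < tau m'.
  move=> m's m'z; rewrite /tau pairingBl subr_gt0 ltNge; apply/negP => H.
  have : [set lat z] (lat m').
    rewrite u0E; split; first exact: hull_mem.
    by move=> y /zmax yz; apply: le_trans yz H.
  by move=> /lattice_pt_inj E; rewrite E eqxx in m'z.
have mz : m != z by apply: contraTneq neg => ->; rewrite subrr pairing0l ltxx.
pose nrm m := (tau m)^-1 *: (lat m - lat z).
pose hs := [seq nrm m | m <- [seq m <- s | m != z]].
have inhs m' : m' \in s -> m' != z -> nrm m' \in hs.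
  by move=> m's m'z; apply: map_f; rewrite mem_filter m'z.
have hs0 : hs != [::].
  by apply/eqP => E; have := inhs m ms mz; rewrite E.
have [h [u' [/mapP[m0 m0f hE] hmax huniq]]] := exposed_max (- col i D) hs0.
move: m0f; rewrite mem_filter => /andP[m0z m0s].
(* The multiple of [u0] is chosen so that [u2] vanishes on [h] and is negative on every other
   normalized direction: [u2] exposes the edge along [h]. *)
pose u2 := u' + pairing h u' *: u0.
have nrmE m' : m' \in s -> m' != z -> lat m' - lat z = tau m' *: nrm m'.
  by move=> m's m'z; rewrite scalerA divff ?scale1r // gt_eqF // tau_gt0.
have u2E m' : m' \in s -> m' != z -> pairing (lat m' - lat z) u2 =
    tau m' * (pairing (nrm m') u' - pairing h u').
  move=> m's m'z; rewrite /u2 pairingDr pairingZr {1}nrmE // pairingZl.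
  have -> : pairing (lat m' - lat z) u0 = - tau m'.
    by rewrite /tau -pairingNl opprB.
  by rewrite mulrBr mulrN mulrC [pairing h u' * _]mulrC.
have u2_le m' : m' \in s -> pairing (lat m') u2 <= pairing (lat z) u2.
  move=> m's; have [->//|m'z] := eqVneq m' z.
  rewrite -subr_le0 -pairingBl u2E // pmulr_rle0 ?tau_gt0 // subr_le0.
  by have [->//|ne] := eqVneq (nrm m') h; rewrite ltW // huniq // inhs.
have u2_eq m' : m' \in s -> pairing (lat m') u2 = pairing (lat z) u2 ->
    lat m' - lat z = tau m' *: h.
  move=> m's E; have [->|m'z] := eqVneq m' z.
    by rewrite /tau subrr pairing0l scale0r.
  rewrite nrmE //; congr (_ *: _); apply/eqP; apply: contraT => ne.
  have := huniq _ (inhs _ m's m'z) ne.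
  have /eqP := u2E _ m's m'z; rewrite pairingBl E subrr eq_sym mulf_eq0 subr_eq0.
  by rewrite gt_eqF ?tau_gt0 //= => /eqP ->; rewrite ltxx.
have m0u2 : pairing (lat m0) u2 = pairing (lat z) u2.
  by apply/eqP; rewrite -subr_eq0 -pairingBl u2E // -hE subrr mulr0.
pose E := [set x | Q x /\ forall y, Q y -> pairing y u2 <= pairing x u2].
have zE : E (lat z).
  split; first exact: Qz.
  move=> y Qy; apply: (hull_le Qy); exact: u2_le.
have m0E : E (lat m0).
  by split; [exact: hull_mem|move=> y Qy; rewrite m0u2; apply: (hull_le Qy); exact: u2_le].
have dm0 : lat m0 - lat z = tau m0 *: h by apply: u2_eq.
have t0 := tau_gt0 _ m0s m0z.
have edgeE : edge Q E.
  split; first by split; [exists (lat z)|exists u2].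
  exists (lat z), (lat m0 - lat z); split=> //.
  - rewrite /row_free rank_rV subr_eq0.
    by have -> : lat m0 != lat z by apply: contra m0z => /eqP/lattice_pt_inj ->.
  - by move=> k; rewrite row_id addrC subrK.
  move=> x [Qx xmax]; have xu : pairing x u2 = pairing (lat z) u2.
    by apply/eqP; rewrite eq_le (hull_le Qx u2_le) xmax.
  have [l [l0 l1 xE lz]] := hull_face Qx u2_le xu.
  apply/sub_rVP; exists ((\sum_k l k * tau (nth 0 s k)) / tau m0).
  rewrite dm0 scalerA divfK ?gt_eqF // scaler_suml.
  rewrite -[in LHS](scale1r (lat z)) -l1 scaler_suml xE -sumrB.
  apply: eq_bigr => k _; rewrite -scalerBr -scalerA.
  have [->|/lz lk] := eqVneq (l k) 0; first by rewrite !scale0r.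
  by rewrite u2_eq // mem_nth.
have m0z0 : m0 - z != 0 by rewrite subr_eq0.
have [e [k [k0 ek prim]]] := primitive_part m0z0.
have : edge_direction Q (lat z) e.
  split=> //; exists E, k%:R; split=> //; first by rewrite ltr0n.
  by rewrite scaler_nat -lattice_ptMn -ek lattice_ptB addrC subrK.
move=> /edges[j ej].
(* The edge along [h] has a row of [B] as primitive direction, so its coordinate [i] is nonnegative,
   although [h] is at least as negative there as the direction of [m]. *)
have : pairing h (- col i D) <= 0.
  rewrite -(pmulr_rle0 _ t0) -pairingZl -dm0 -lattice_ptB ek lattice_ptMn pairingMnl.
  by rewrite ej pairingNr smooth_dual mulNrn oppr_le0 mulrn_wge0.
rewrite leNgt => /negP; apply; apply: lt_le_trans (hmax _ (inhs _ ms mz)).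
by rewrite pairingZl pairingNr mulr_gt0 ?invr_gt0 ?tau_gt0 // oppr_gt0.
Qed.

Lemma smooth_frame : frame Q z B D.
Proof.
have Qz : Q (lat z).
  by have [[x E] [u uE]] := vz; have : [set lat z] (lat z) by []; rewrite uE => -[].
split=> //; first exact: smooth_dual_basis.
  move=> x Qx i; rewrite pairingBl subr_ge0 -lerN2 -!pairingNr.
  apply: hull_le Qx _ => m ms; rewrite !pairingNr lerN2 -subr_ge0 -pairingBl.
  exact: smooth_tangent_cone.
move=> i; have /edges[_ [E [c [[[_ [u ->]] _] _ c0 [Qc _]]]]] : exists j, row i B = row j B.
  by exists i.
by exists c.
Qed.

(** Minus the sum of the other facet normals is maximal exactly on the edge; maximizing coordinate
    [i] along it reaches the far end. *)
Lemma edge_other_end i : exists z' (l : R),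
  [/\ vertex Q (lat z'), 1 <= l, lat z' = lat z + l *: lat (row i B) &
      edge_direction Q (lat z') (- row i B)].
Proof.
have fr := smooth_frame; have [Qz _ Hpos Hrow] := fr.
have [c c0 Qc] := Hrow i; set x := lat z + c *: lat (row i B) in Qc.
pose u : 'cV[R]_n := - \sum_(j | j != i) col j D.
have uE y : pairing y u - pairing (lat z) u =
    - \sum_(j | j != i) pairing (y - lat z) (col j D).
  by rewrite -pairingBl pairingNr pairing_sumr.
have u_le y : Q y -> pairing y u <= pairing (lat z) u.
  move=> Qy; rewrite -subr_le0 uE oppr_le0; apply: sumr_ge0 => j _; exact: Hpos.
have u_eq y : Q y -> pairing y u = pairing (lat z) u ->
    y = lat z + pairing (y - lat z) (col i D) *: lat (row i B).
  move=> Qy /eqP; rewrite -subr_eq0 uE oppr_eq0 => /eqP S0.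
  have ge0 j : j != i -> 0 <= pairing (y - lat z) (col j D) by move=> _; exact: Hpos.
  rewrite -[LHS](subrK (lat z)) addrC {1}(frame_expand fr (y - lat z)) (bigD1 i) //=.
  by rewrite big1 ?addr0 // => j ji; rewrite (psumr_eq0P ge0 S0) // scale0r.
have xu : pairing x u = pairing (lat z) u.
  apply/eqP; rewrite -subr_eq0 uE oppr_eq0 big1 // => j ji.
  by rewrite addrC addKr pairingZl smooth_dual eq_sym (negbTE ji) mulr0.
(* Since [x] lies on the edge beyond [z], some generator carrying weight in [x] does too. Its
   coordinate is a positive integer because the dual basis is integral. *)
have [m [ms mu mi]] : exists m, [/\ m \in s, pairing (lat m) u = pairing (lat z) u &
    0 < pairing (lat m - lat z) (col i D)].
  have [l [l0 l1 xE lz]] := hull_face Qc (fun m ms => u_le _ (hull_mem R ms)) xu.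
  apply: contrapT => H; suff : c <= 0 by rewrite leNgt c0.
  have -> : c = pairing (x - lat z) (col i D).
    by rewrite addrC addKr pairingZl smooth_dual eqxx mulr1.
  have zE : lat z = \sum_k l k *: lat z by rewrite -scaler_suml l1 scale1r.
  rewrite xE zE -sumrB pairing_suml.
  apply: sumr_le0 => k _; rewrite -scalerBr pairingZl.
  have [->|lk] := eqVneq (l k) 0; first by rewrite mul0r.
  apply: mulr_ge0_le0 => //; rewrite leNgt; apply/negP => gt; apply: H.
  by exists (nth 0 s k); rewrite mem_nth // lz.
have mi1 : 1 <= pairing (lat m - lat z) (col i D).
  have E : pairing (lat m - lat z) (col i D) = (pairing (m - z) (col i (invmx B)))%:~R.
    by rewrite -pairing_lattice lattice_ptB map_col.
  by move: mi; rewrite E ltr0z ler1z gtz0_ge1.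
have [z' [z's vz' z'u z'i]] := lex_max_vertex u (col i D) (ex_intro _ _ Qz).
have z'uE : pairing (lat z') u = pairing (lat z) u.
  by apply/eqP; rewrite eq_le z'u // u_le //; apply: hull_mem.
exists z', (pairing (lat z' - lat z) (col i D)); split=> //.
- apply: le_trans mi1 _; rewrite !pairingBl lerD2r z'i ?mu ?z'uE //; exact: hull_mem.
- by apply: u_eq => //; apply: hull_mem.
have /edges[prim [E [c' [eE Ez c'0 Ec']]]] : exists j, row i B = row j B by exists i.
split; first exact: primitiveN.
have z'E := u_eq _ (hull_mem R z's) z'uE.
set l := pairing _ _ in z'E.
have l0 : 0 < l.
  apply: lt_le_trans ltr01 (le_trans mi1 _); rewrite /l !pairingBl lerD2r.
  by rewrite z'i ?mu ?z'uE //; exact: hull_mem.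
exists E, l; split=> //; last by rewrite z'E lattice_ptN scalerN addrK.
have [[_ [w wE]] _] := eE; move: Ez Ec'; rewrite !wE => -[_ zw] [Qc' c'w].
have rw : pairing (lat (row i B)) w = 0.
  apply/eqP; rewrite eq_le; apply/andP; split.
    by have := zw _ Qc'; rewrite pairingDl pairingZl gerDl pmulr_rle0.
  by have := c'w _ Qz; rewrite pairingDl pairingZl lerDl pmulr_rge0.
split; first exact: hull_mem.
by move=> y /zw; rewrite z'E pairingDl pairingZl rw mulr0 addr0.
Qed.

Lemma edge_lattice_step i : Q (lat z + lat (row i B)).
Proof.
have [z' [l [[[y yE] [u uE]] l1 z'E _]]] := edge_other_end i.
have Qz' : Q (lat z') by have : [set lat z'] (lat z') by []; rewrite uE => -[].
have [Qz _ _ _] := smooth_frame.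
have l0 : 0 < l by apply: lt_le_trans ltr01 l1.
have := @hull_convex _ _ _ _ _ l^-1 _ Qz Qz'.
rewrite invr_ge0 ltW //= invf_le1 // l1 => /(_ isT).
by rewrite z'E scalerDr addrA -scalerDl subrK scale1r scalerA mulVf ?scale1r ?gt_eqF.
Qed.

End AtVertex.
End SmoothVertex.

(** * Vertices of the truncated polytope *)

Section Truncation.
Variables (R : realType) (n : nat) (s : seq 'rV[int]_n).
Local Notation lat := (@lattice_pt R n).
Local Notation Q := (@convex_hull R n s).
Local Notation P := (truncation Q).
Implicit Types (x : 'rV[R]_n) (u : 'cV[R]_n) (y z : 'rV[int]_n) (i j : 'I_n).

Variable Bf : 'rV[int]_n -> 'M[int]_n.
Hypothesis Bf_spec : forall z, vertex Q (lat z) -> Bf z \in unitmx /\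
  forall e, edge_direction Q (lat z) e <-> exists i, e = row i (Bf z).
Hypothesis corners : disjoint_corners Q.

Definition vertex_dual z : 'M[R]_n := map_mx intr (invmx (Bf z)).
Local Notation Df := vertex_dual.

(** It is 0 at [z] and 1 on the cutting hyperplane there. *)
Definition corner_height z x : R := pairing (x - lat z) (\sum_i col i (Df z)).

Lemma vertex_frame z : vertex Q (lat z) -> frame Q z (Bf z) (Df z).
Proof. by move=> vz; have [Bu ed] := Bf_spec vz; apply: smooth_frame. Qed.

Lemma corner_heightE z x :
  corner_height z x = \sum_i pairing (x - lat z) (col i (Df z)).
Proof. exact: pairing_sumr. Qed.

Lemma corner_height_edge z i (c : R) : vertex Q (lat z) ->
  corner_height z (lat z + c *: lat (row i (Bf z))) = c.
Proof.
move=> vz; rewrite corner_heightE (bigD1 i) //= addrKl big1 => [|j ji].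
  by rewrite addr0 pairingZl (frame_dual (vertex_frame vz)) eqxx mulr1.
by rewrite pairingZl (frame_dual (vertex_frame vz)) eq_sym (negbTE ji) mulr0.
Qed.

Lemma vertex_cutting z : vertex Q (lat z) ->
  cutting_hyperplane Q (lat z) (\sum_i col i (Df z))
    (pairing (lat z) (\sum_i col i (Df z)) + 1).
Proof.
move=> vz; split; first by rewrite ltrDl.
move=> e /(Bf_spec vz).2[i ->]; rewrite pairingDl; congr (_ + _).
have := corner_height_edge i 1 vz.
by rewrite /corner_height addrKl scale1r.
Qed.

Lemma truncation_corner_height z x : vertex Q (lat z) -> P x -> 1 <= corner_height z x.
Proof.
move=> vz [_ /(_ _ _ _ vz (vertex_cutting vz))].
by rewrite /corner_height pairingBl; lra.
Qed.

Lemma corner_disjoint z z' x : vertex Q (lat z) -> vertex Q (lat z') -> z != z' ->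
  Q x -> corner_height z x <= 1 -> 1 < corner_height z' x.
Proof.
move=> vz vz' zz' Qx xz; rewrite ltNge; apply/negP => xz'.
have ne : lat z <> lat z' by move=> /lattice_pt_inj E; rewrite E eqxx in zz'.
apply: (corners vz vz' ne (vertex_cutting vz) (vertex_cutting vz') Qx).
by move: xz xz'; rewrite /corner_height !pairingBl; lra.
Qed.

Lemma new_vertex_hull z i : vertex Q (lat z) -> Q (lat (z + row i (Bf z))).
Proof.
move=> vz; rewrite lattice_ptD; have [Bu ed] := Bf_spec vz.
exact: (edge_lattice_step vz Bu ed).
Qed.

Lemma new_vertex_height z i : vertex Q (lat z) ->
  corner_height z (lat (z + row i (Bf z))) = 1.
Proof. by move=> vz; rewrite lattice_ptD -[lat (row _ _)]scale1r corner_height_edge. Qed.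

Lemma new_vertex_truncation z i : vertex Q (lat z) -> P (lat (z + row i (Bf z))).
Proof.
move=> vz; have Qx := new_vertex_hull i vz; split=> // w a b vw cw.
have [wz|wz] := EM (w = lat z).
  have [_ /(_ (row i (Bf z)))] := cw; rewrite wz lattice_ptD => -> //.
  by apply/(Bf_spec vz).2; exists i.
rewrite leNgt; apply/negP => lt; have zw : lat z <> w by move=> E; apply: wz.
apply: (corners vz vw zw (vertex_cutting vz) cw Qx); split; last exact: ltW.
by have := new_vertex_height i vz; rewrite /corner_height pairingBl; lra.
Qed.

Definition new_vertices : set 'rV[int]_n :=
  [set y | exists z i, vertex Q (lat z) /\ y = z + row i (Bf z)].

(** At the new vertex on edge [i], one direction continues along that edge and the others run inside
    the cut towards the other new vertices near [z]. In the dual basis only the [i]-th vector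
    changes, into the cutting functional. *)
Definition new_basis z i : 'M[int]_n :=
  \matrix_(j, k) (if j == i then Bf z i k else Bf z j k - Bf z i k).

Definition new_dual z i : 'M[R]_n :=
  \matrix_(k, j) (if j == i then (\sum_l col l (Df z)) k 0 else Df z k j).

Lemma row_new_basis z i j : row j (new_basis z i) =
  if j == i then row i (Bf z) else row j (Bf z) - row i (Bf z).
Proof. by apply/rowP => k; rewrite !mxE; case: ifP; rewrite !mxE. Qed.

Lemma col_new_dual z i j : col j (new_dual z i) =
  if j == i then \sum_l col l (Df z) else col j (Df z).
Proof. by apply/colP => k; rewrite !mxE; case: ifP; rewrite ?mxE. Qed.

Lemma new_vertex_frame z i : vertex Q (lat z) ->
  frame P (z + row i (Bf z)) (new_basis z i) (new_dual z i).
Proof.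
move=> vz; have fr := vertex_frame vz; have [Qz BD Hpos Hrow] := fr.
have Py := new_vertex_truncation i vz.
have sumd j : pairing (lat (row j (Bf z))) (\sum_l col l (Df z)) = 1.
  rewrite pairing_sumr (bigD1 j) //= (frame_dual fr) eqxx big1 ?addr0 // => k kj.
  by rewrite (frame_dual fr) eq_sym (negbTE kj).
split=> //.
- apply/matrixP => j k; rewrite -pairing_row -row_lattice_pt row_new_basis col_new_dual mxE.
  case: (eqVneq j i) => [->|ji]; case: (eqVneq k i) => [ki|ki].
  + by rewrite sumd.
  + by rewrite (frame_dual fr) eq_sym (negbTE ki).
  + by rewrite lattice_ptB pairingBl !sumd subrr ki (negbTE ji).
  by rewrite lattice_ptB pairingBl !(frame_dual fr) [i == k]eq_sym (negbTE ki) subr0.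
- move=> x Px j; rewrite col_new_dual lattice_ptD opprD addrA pairingBl.
  case: (eqVneq j i) => [_|ji].
    by rewrite sumd subr_ge0; apply: truncation_corner_height.
  rewrite (frame_dual fr) eq_sym (negbTE ji) subr0; apply: Hpos.
  by case: Px.
move=> j; rewrite row_new_basis; case: (eqVneq j i) => [_|ji]; last first.
  exists 1 => //; rewrite scale1r -lattice_ptD -addrA subrKC.
  exact: new_vertex_truncation.
have [Bu ed] := Bf_spec vz.
(* What remains of the old edge must have positive length. Its far end is cut too, at distance l - 1
   from [z]; disjointness of the corners gives l - 1 > 1, leaving length l - 2. *)
have [z' [l [vz' l1 z'E /(Bf_spec vz').2[i' ei']]]] := edge_other_end vz Bu ed i.
have Px' := new_vertex_truncation i' vz'.
have x'E : lat (z' + row i' (Bf z')) = lat z + (l - 1) *: lat (row i (Bf z)).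
  by rewrite -ei' lattice_ptB z'E scalerBl scale1r addrA.
have ne : z' != z.
  apply/eqP => E; move: z'E; rewrite E => /eqP; rewrite addrC -subr_eq subrr eq_sym.
  rewrite scaler_eq0 gt_eqF ?(lt_le_trans ltr01) //= => /eqP E0.
  have := frame_dual fr i i; rewrite E0 pairing0l eqxx => /esym/eqP.
  by rewrite oner_eq0.
have := corner_disjoint vz' vz ne (new_vertex_hull i' vz').
rewrite new_vertex_height // lexx => /(_ isT); rewrite x'E corner_height_edge // => l2.
exists (l - 2); first by rewrite subr_gt0; lra.
move: Px'; rewrite x'E lattice_ptD -addrA -{2}[lat (row i (Bf z))]scale1r -scalerDl.
by have -> : 1 + (l - 2) = l - 1 by ring.
Qed.

(** Take [z] maximal on [Q] and the edge there of least descent. A point of the truncation has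
    nonnegative coordinates at [z] of sum at least 1, and all slopes are at most that of the chosen
    edge, which is nonpositive. *)
Lemma truncation_max u (i0 : 'I_n) : (exists x, Q x) -> exists z i,
  vertex Q (lat z) /\
  forall x, P x -> pairing x u <= pairing (lat (z + row i (Bf z))) u.
Proof.
move=> Q0; have [z [_ vz zu _]] := lex_max_vertex u u Q0.
have e0 : enum 'I_n != [::].
  by apply/eqP => E; have := mem_enum 'I_n i0; rewrite E.
have [i _ imax] := seq_max (fun i => pairing (lat (row i (Bf z))) u) e0.
exists z, i; split=> // x Px; have fr := vertex_frame vz.
have [_ _ Hpos _] := fr.
rewrite lattice_ptD pairingDl -lerBlDl -pairingBl (frame_pairing fr).
have fi : pairing (lat (row i (Bf z))) u <= 0.
  have := zu _ (new_vertex_hull i vz); rewrite lattice_ptD pairingDl.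
  by rewrite gerDl.
apply: (@le_trans _ _ (corner_height z x * pairing (lat (row i (Bf z))) u)).
  rewrite corner_heightE mulr_suml; apply: ler_sum => k _.
  by rewrite ler_wpM2l ?imax ?mem_enum // Hpos //; case: Px.
by have := truncation_corner_height vz Px; nra.
Qed.

Lemma new_vertices_frame y : new_vertices y -> exists B D, frame P y B D.
Proof.
by move=> [z [i [vz ->]]]; exists (new_basis z i), (new_dual z i); exact: new_vertex_frame.
Qed.

Lemma new_vertices_face (i0 : 'I_n) F : face P F -> exists2 y, new_vertices y & F (lat y).
Proof.
move=> [[x Fx] [u uE]]; have Px : P x by move: Fx; rewrite uE => -[].
have [z [i [vz zmax]]] := truncation_max u i0 (ex_intro _ x Px.1).
exists (z + row i (Bf z)); first by exists z, i.
by rewrite uE; split=> //; exact: new_vertex_truncation.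
Qed.

(** Disjoint corners keep the new vertices of other corners away; hence a cut has no vertices but
    the expected ones. *)
Lemma new_vertices_corner y z : new_vertices y -> vertex Q (lat z) ->
  corner_height z (lat y) <= 1 -> exists i, y = z + row i (Bf z).
Proof.
move=> [z' [i [vz' ->]]] vz H; have [<-|ne] := eqVneq z' z; first by exists i.
have := corner_disjoint vz' vz ne (new_vertex_hull i vz').
by rewrite new_vertex_height // lexx => /(_ isT); rewrite ltNge H.
Qed.

End Truncation.

(** * Invariance under dilation *)

Section Scaling.
Variables (R : realType) (n : nat).
Implicit Types (P F : set 'rV[R]_n) (x w : 'rV[R]_n) (c : R).

(** A real factor is invertible, so transfer in one direction yields the other. *)
Definition scale_set c P : set 'rV[R]_n := [set c *: x | x in P].

Lemma scale_setP c P x : c != 0 -> scale_set c P x <-> P (c^-1 *: x).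
Proof.
move=> c0; split=> [[y Py <-]|H]; first by rewrite scalerA mulVf ?scale1r.
by exists (c^-1 *: x) => //; rewrite scalerA divff ?scale1r.
Qed.

Lemma scale_setK c P : c != 0 -> scale_set c^-1 (scale_set c P) = P.
Proof.
move=> c0; apply/seteqP; split=> x.
  by move=> /(scale_setP _ _ (invr_neq0 c0))/(scale_setP _ _ c0);
    rewrite invrK scalerA mulVf // scale1r.
move=> Px; apply/(scale_setP _ _ (invr_neq0 c0))/(scale_setP _ _ c0).
by rewrite invrK scalerA mulVf // scale1r.
Qed.

Lemma scale_setI c P F : c != 0 ->
  scale_set c (P `&` F) = scale_set c P `&` scale_set c F.
Proof.
move=> c0; apply/seteqP; split=> x.
  by move=> /(scale_setP _ _ c0)[] ? ?; split; apply/(scale_setP _ _ c0).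
by move=> [] /(scale_setP _ _ c0) ? /(scale_setP _ _ c0) ?; apply/(scale_setP _ _ c0).
Qed.

Lemma scale_set1 c w : scale_set c [set w] = [set c *: w].
Proof. by apply/seteqP; split=> x; [move=> [_ -> <-]|move=> ->; exists w]. Qed.

Lemma scale_face c P F : 0 < c -> face P F -> face (scale_set c P) (scale_set c F).
Proof.
move=> c0 [[x Fx] [u uE]]; have cn : c != 0 by rewrite gt_eqF.
split; first by exists (c *: x), x.
exists u; apply/seteqP; split=> y.
  move=> [z]; rewrite uE => -[Pz zmax] <-; split; first by exists z.
  by move=> _ [t Pt <-]; rewrite !pairingZl ler_pM2l // zmax.
move=> [[z Pz <-] zmax]; exists z => //; rewrite uE; split=> // t Pt.
by rewrite -(ler_pM2l c0) -!pairingZl; apply: zmax; exists t.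
Qed.

Lemma scale_has_dim c F d : 0 < c -> has_dim F d -> has_dim (scale_set c F) d.
Proof.
move=> c0 [x0 [A [Fx0 Afree FA Fsub]]]; have cn : c != 0 by rewrite gt_eqF.
exists (c *: x0), (c *: A); split.
- by exists x0.
- by rewrite /row_free mxrank_scale_nz.
- by move=> i; exists (x0 + row i A) => //; rewrite scalerDr linearZ.
move=> _ [x Fx <-]; rewrite -scalerBr (eqmx_scale A cn); apply: scalemx_sub.
exact: Fsub.
Qed.

Lemma scale_vertex c P w : 0 < c -> vertex P w -> vertex (scale_set c P) (c *: w).
Proof. by move=> c0 vw; rewrite /vertex -scale_set1; apply: scale_face. Qed.

Lemma scale_edge_direction c P w e : 0 < c -> edge_direction P w e ->
  edge_direction (scale_set c P) (c *: w) e.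
Proof.
move=> c0 [prim [E [d [[fE dE] Ew d0 Ed]]]]; split=> //.
exists (scale_set c E), (c * d); split.
- by split; [apply: scale_face|apply: scale_has_dim].
- by exists w.
- exact: mulr_gt0.
by exists (w + d *: lattice_pt R e) => //; rewrite scalerDr scalerA.
Qed.

Lemma scale_adjacent_facets c P F1 F2 : 0 < c -> adjacent_facets P F1 F2 ->
  adjacent_facets (scale_set c P) (scale_set c F1) (scale_set c F2).
Proof.
move=> c0 [[f1 d1] [f2 d2] f12 d12]; have cn : c != 0 by rewrite gt_eqF.
split; rewrite -?scale_setI //; last 2 first.
- exact: scale_face.
- exact: scale_has_dim.
- by split; [apply: scale_face|apply: scale_has_dim].
by split; [apply: scale_face|apply: scale_has_dim].
Qed.

(** Weights indexed by [nat] pass unchanged to the image of [s] under a map, where the ordinal type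
    differs. *)
Lemma convex_hull_nat (s : seq 'rV[int]_n) x : convex_hull s x <->
  exists l : nat -> R, [/\ forall i, 0 <= l i, \sum_(i < size s) l i = 1 &
    x = \sum_(i < size s) l i *: lattice_pt R (nth 0 s i)].
Proof.
split=> [[l [l0 l1 ->]]|[l [l0 l1 ->]]]; last by exists (fun i => l i).
exists (fun i => oapp l 0 (insub i)); split.
- by move=> i; case: insubP => [j _ _|_] /=; rewrite ?l0 ?lexx.
- by rewrite -l1; apply: eq_bigr => i _; rewrite valK.
by apply: eq_bigr => i _; rewrite valK.
Qed.

Lemma dilation_scale (k : nat) P : dilation k P = scale_set k%:R P.
Proof. by apply/seteqP; split=> x [y Py <-]; exists y; rewrite ?scaler_nat. Qed.

Lemma dilation_lattice_polytope k P : lattice_polytope P -> lattice_polytope (dilation k P).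
Proof.
move=> [s ->]; exists [seq m *+ k | m <- s]; apply/seteqP; split=> x.
  move=> [y /convex_hull_nat[l [l0 l1 ->]] <-]; apply/convex_hull_nat.
  rewrite size_map; exists l; split=> //; rewrite -sumrMnl; apply: eq_bigr => i _.
  by rewrite (nth_map 0) // lattice_ptMn scalerMnr.
move=> /convex_hull_nat; rewrite size_map => -[l [l0 l1 ->]].
exists (\sum_(i < size s) l i *: lattice_pt R (nth 0 s i)).
  by apply/convex_hull_nat; exists l.
rewrite -sumrMnl; apply: eq_bigr => i _.
by rewrite (nth_map 0) // lattice_ptMn scalerMnr.
Qed.

Lemma dilation_smooth k P : (0 < k)%N -> smooth_polytope P ->
  smooth_polytope (dilation k P).
Proof.
move=> k0 [lP dP sP]; have c0 : 0 < k%:R :> R by rewrite ltr0n.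
have cn : k%:R != 0 :> R by rewrite gt_eqF.
have c'0 : 0 < k%:R^-1 :> R by rewrite invr_gt0.
split; first exact: dilation_lattice_polytope.
  by rewrite dilation_scale; apply: scale_has_dim.
rewrite dilation_scale => w /(scale_vertex c'0); rewrite scale_setK // => /sP[B Bu HB].
exists B => // e; rewrite -HB; split=> [/(scale_edge_direction c'0)|].
  by rewrite scale_setK.
by move=> /(scale_edge_direction c0); rewrite scalerA divff // scale1r.
Qed.

End Scaling.

(** * Dimension of faces, and index sets of three elements *)

Section FrameDim.
Variables (R : realType) (n : nat).
Local Notation lat := (@lattice_pt R n).

Lemma frame_face_dim (P F : set 'rV[R]_n) y B D (J : pred 'I_n) d (h : 'I_d -> 'I_n) :
  frame P y B D -> injective h -> (forall i, J i <-> exists k, h k = i) ->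
  F = [set x | P x /\ forall i, ~~ J i -> pairing (x - lat y) (col i D) = 0] ->
  has_dim F d.
Proof.
move=> fr hinj Jh FE; have [Py _ _ Hrow] := fr.
(* The lengths [c] keep the edge vectors inside [P]; dual columns rescaled by their inverses form
   the right inverse [C]. *)
have [c Hc] := choice (fun k => (let: ex_intro2 c c0 Pc := Hrow (h k) in
  ex_intro _ c (conj c0 Pc)) : exists c, 0 < c /\ P (lat y + c *: lat (row (h k) B))).
pose A : 'M[R]_(d, n) := \matrix_(k, l) (c k * lat (row (h k) B) 0 l).
have rowA k : row k A = c k *: lat (row (h k) B).
  by apply/rowP => l; rewrite !mxE.
pose C : 'M[R]_(n, d) := \matrix_(l, k) ((c k)^-1 * D l (h k)).
have colC k : col k C = (c k)^-1 *: col (h k) D.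
  by apply/colP => l; rewrite !mxE.
exists (lat y), A; split.
- by rewrite FE; split=> // i _; rewrite subrr pairing0l.
- apply/row_freeP; exists C; apply/matrixP => k l; rewrite -pairing_row rowA colC.
  rewrite pairingZl pairingZr (frame_dual fr) mxE (inj_eq hinj).
  case: eqP => [->|_]; last by rewrite !mulr0.
  by rewrite mulr1 divff // gt_eqF //; case: (Hc l).
- move=> k; rewrite rowA FE; split; first by case: (Hc k).
  move=> i Ji; rewrite addrKl pairingZl (frame_dual fr).
  have -> : (h k == i) = false; last by rewrite mulr0.
  by apply: contraNF Ji => /eqP E; apply/Jh; exists k.
move=> x; rewrite FE => -[Px Hx]; rewrite (frame_expand fr (x - lat y)).
apply: summx_sub => i _; case: (boolP (J i)) => [/Jh[k <-]|/Hx ->]; last first.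
  by rewrite scale0r sub0mx.
have ck : c k != 0 by rewrite gt_eqF //; case: (Hc k).
rewrite -[lat (row _ _)](scalerK ck) -rowA scalerA; apply: scalemx_sub; exact: row_sub.
Qed.

End FrameDim.

Section Three.

Lemma ord3_cases (i1 i2 i3 k : 'I_3) : i1 != i2 -> i2 != i3 -> i1 != i3 ->
  [|| k == i1, k == i2 | k == i3].
Proof.
by case: i1 i2 i3 k => [[|[|[|//]]] ?] [[|[|[|//]]] ?] [[|[|[|//]]] ?] [[|[|[|//]]] ?].
Qed.

Lemma ord3_others (i : 'I_3) : exists j k : 'I_3, [/\ j != i, k != i & j != k].
Proof.
exists (lift i ord0), (lift i (lift ord0 ord0)); split; rewrite 1?eq_sym ?neq_lift //.
by rewrite (inj_eq lift_inj).
Qed.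

Lemma ord3_sort (f : 'I_3 -> int) : (forall i j, i != j -> f i != f j) ->
  exists i j k, [/\ f i < f j, f j < f k, i != j, j != k & i != k].
Proof.
move=> inj; have lt_ne i j : f i < f j -> i != j.
  by apply: contraTneq => ->; rewrite ltxx.
suff [i [j [k [ij jk]]]] : exists i j k, f i < f j /\ f j < f k.
  by exists i, j, k; split=> //; apply: lt_ne => //; apply: lt_trans jk.
pose a : 'I_3 := ord0; pose b := lift a ord0; pose c := lift a (lift ord0 ord0).
have ab : f a != f b by exact: inj.
have bc : f b != f c by exact: inj.
have ac : f a != f c by exact: inj.
case: (ltgtP (f a) (f b)) ab => // {}ab _; case: (ltgtP (f b) (f c)) bc => // {}bc _;
  case: (ltgtP (f a) (f c)) ac => // {}ac _.
- by exists a, b, c.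
- by exists a, b, c.
- by exists a, c, b.
- by exists c, a, b.
- by exists b, a, c.
- by exists b, c, a.
- by exists c, b, a.
by exists c, b, a.
Qed.

End Three.

(** * Choice of the triangle and of the plus cell in dimension three *)

Section Pop.
Variables (R : realType) (K : closedFieldType) (s : seq 'rV[int]_3).
Local Notation lat := (@lattice_pt R 3).
Local Notation Q := (@convex_hull R 3 s).
Local Notation P := (truncation Q).
Implicit Types (x : 'rV[R]_3) (z w : 'rV[int]_3) (i j k : 'I_3).

Variable Bf : 'rV[int]_3 -> 'M[int]_3.
Hypothesis Bf_spec : forall z, vertex Q (lat z) -> Bf z \in unitmx /\
  forall e, edge_direction Q (lat z) e <-> exists i, e = row i (Bf z).
Hypothesis corners : disjoint_corners Q.
Hypothesis Q_nonempty : exists x, Q x.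
Hypothesis no_cover : ~ (exists F1 F2, adjacent_facets Q F1 F2 /\
  forall x, vertex Q x -> F1 x \/ F2 x).

Local Notation Df := (@vertex_dual R 3 Bf).
Local Notation dir z i := (row i (Bf z)).
Local Notation fr := (@vertex_frame _ _ _ _ Bf_spec _).

(** The coordinates other than [i] vanish on the two facets through edge [i]. These are adjacent
    along that edge, so by [no_cover] some vertex avoids both. *)
Lemma vertex_off_edge_facets z i : vertex Q (lat z) ->
  exists2 w, vertex Q (lat w) &
    forall j, j != i -> pairing (lat w - lat z) (col j (Df z)) != 0.
Proof.
move=> vz; have frz := fr vz; have [j1 [j2 [j1i j2i j12]]] := ord3_others i.
have facet_of j : exists F, facet Q F /\
    F = [set x | Q x /\ forall k, ~~ predC1 j k -> pairing (x - lat z) (col k (Df z)) = 0].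
  have [F [fF _ _ FE]] := frame_face frz (predC1 j).
  exists F; split=> //; split=> //.
  apply: (frame_face_dim (h := lift j) frz (@lift_inj _ j) _ FE) => k /=.
  split=> [kj|[l <-]]; last by rewrite eq_sym neq_lift.
  by case: (unliftP j k) kj => [l ->|->]; [exists l|rewrite eqxx].
have [F1 [fF1 F1E]] := facet_of j1; have [F2 [fF2 F2E]] := facet_of j2.
have [F [fF _ _ FE]] := frame_face frz (pred1 i).
have F12 : F1 `&` F2 = F.
  rewrite F1E F2E FE; apply/seteqP; split=> x.
    move=> [[Qx x1] [_ x2]]; split=> // k /= ki.
    have := ord3_cases k j1i _ j12; rewrite [i == j2]eq_sym j2i => /(_ isT).
    rewrite (negbTE ki) /= => /orP[] /eqP ->; [apply: x1|apply: x2] => /=;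
      by rewrite negbK.
  move=> [Qx Hx]; split; split=> // k /=; rewrite negbK => /eqP ->; exact: Hx.
have adj : adjacent_facets Q F1 F2.
  split=> //; rewrite F12 //.
  apply: (frame_face_dim (h := fun _ : 'I_1 => i) frz _ _ FE) => [k l _|k /=].
    by rewrite !ord1.
  by split=> [/eqP ->|[_ ->]]; [exists ord0|].
apply: contrapT => H; apply: no_cover; exists F1, F2; split=> // x vx.
have [w _ wE] := vertex_hull vx; apply: contrapT => /not_orP[n1 n2]; apply: H.
rewrite wE in vx n1 n2; exists w => // j ji; have [Qw _ _ _] := fr vx.
have := ord3_cases j j1i _ j12; rewrite [i == j2]eq_sym j2i => /(_ isT).
rewrite (negbTE ji) /= => /orP[] /eqP ->; apply/eqP => E.
  by apply: n1; rewrite F1E; split=> // k /=; rewrite negbK => /eqP ->.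
by apply: n2; rewrite F2E; split=> // k /=; rewrite negbK => /eqP ->.
Qed.

(* If the facet functional were negative on two edge directions at z, the facet
   would lie on a line. *)
Lemma facet_missing_edge z w i1 i2 i3 : vertex Q (lat z) -> vertex Q (lat w) ->
  i1 != i2 -> i2 != i3 -> i1 != i3 ->
  pairing (lat z) (- col i2 (Df w)) = pairing (lat w) (- col i2 (Df w)) ->
  exists k3, pairing (lat (dir z k3)) (- col i2 (Df w)) < 0 /\
    forall k, k != k3 -> pairing (lat (dir z k)) (- col i2 (Df w)) = 0.
Proof.
move=> vz vw i12 i23 i13; set u := - _ => zu.
have frz := fr vz; have frw := fr vw; have [Qw _ wpos _] := frw.
have [_ _ zpos _] := frz.
have u_le x : Q x -> pairing x u <= pairing (lat w) u.
  by move=> Qx; rewrite -subr_le0 -pairingBl pairingNr oppr_le0 wpos.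
have du i : pairing (lat (dir w i)) u = - (i == i2)%:R.
  by rewrite pairingNr (frame_dual frw).
have t_le k : pairing (lat (dir z k)) u <= 0.
  have := u_le _ (new_vertex_hull Bf_spec k vz).
  by rewrite lattice_ptD pairingDl zu gerDl.
have off k x : pairing (lat (dir z k)) u < 0 -> Q x -> pairing x u = pairing (lat w) u ->
    pairing (x - lat z) (col k (Df z)) = 0.
  move=> tk Qx xu.
  have E : \sum_j pairing (x - lat z) (col j (Df z)) * - pairing (lat (dir z j)) u = 0.
    under eq_bigr do rewrite mulrN.
    by rewrite sumrN -(frame_pairing frz) pairingBl xu zu subrr oppr0.
  have ge0 j : true ->
      0 <= pairing (x - lat z) (col j (Df z)) * - pairing (lat (dir z j)) u.
    by move=> _; rewrite mulr_ge0 ?zpos // oppr_ge0.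
  have /eqP := psumr_eq0P ge0 E (i := k) isT.
  by rewrite mulf_eq0 oppr_eq0 (lt_eqF tk) orbF => /eqP.
have [k3 k3neg] : exists k3, pairing (lat (dir z k3)) u < 0.
  apply: contrapT => H.
  have : pairing (lat (dir w i2)) u = 0.
    rewrite (frame_pairing frz) big1 // => j _.
    suff -> : pairing (lat (dir z j)) u = 0 by rewrite mulr0.
    by apply/eqP; rewrite eq_le t_le leNgt; apply/negP => lt; apply: H; exists j.
  by rewrite du eqxx => /eqP; rewrite oppr_eq0 oner_eq0.
exists k3; split=> // k kk3; apply/eqP; rewrite eq_le t_le leNgt; apply/negP => kneg.
have [p [kp k3p]] : exists p, k != p /\ k3 != p.
  have [a [b [ak bk ab]]] := ord3_others k.
  have [E|ne] := eqVneq a k3; first by exists b; rewrite -E eq_sym.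
  by exists a; split; rewrite eq_sym.
(* The directions [i1] and [i3] at [w] both lie in the facet, so both would be multiples of
   [dir z p], against their independence. *)
have line i : i != i2 ->
    lat (dir w i) = pairing (lat (dir w i)) (col p (Df z)) *: lat (dir z p).
  move=> ii2; rewrite {1}(frame_expand frz (lat (dir w i))) (bigD1 p) //=.
  rewrite big1 ?addr0 // => j jp.
  have jneg : pairing (lat (dir z j)) u < 0.
    have := ord3_cases j kk3 k3p kp.
    by rewrite (negbTE jp) orbF => /orP[] /eqP ->.
  have h1 := off j _ jneg Qw erefl.
  have h2 : pairing (lat (w + dir w i) - lat z) (col j (Df z)) = 0.
    apply: off => //; first exact: new_vertex_hull.
    by rewrite lattice_ptD pairingDl du (negbTE ii2) oppr0 addr0.
  move: h2; rewrite lattice_ptD addrAC pairingDl h1 add0r => ->.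
  by rewrite scale0r.
have l1 := line i1 i12; have l3 := line i3; rewrite eq_sym i23 in l3.
have {}l3 := l3 isT.
have e11 := frame_dual frw i1 i1; have e31 := frame_dual frw i3 i1.
have e33 := frame_dual frw i3 i3.
move: e11 e31 e33; rewrite l1 l3 !pairingZl !eqxx [i3 == i1]eq_sym (negbTE i13).
move=> e11 /eqP; rewrite mulf_eq0 => /orP[] /eqP e0 e33.
  by move: e33; rewrite e0 mul0r => /eqP; rewrite eq_sym oner_eq0.
by move: e11; rewrite e0 mulr0 => /eqP; rewrite eq_sym oner_eq0.
Qed.

Theorem truncation_not_well_rounded (v : 'cV[int]_3) :
  polytope_admissible K P v -> ~ polytope_well_rounded K P v.
Proof.
rewrite /polytope_admissible => adm; pose V := @new_vertices R 3 s Bf.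
pose vR : 'cV[R]_3 := map_mx intr v.
have Vfr : forall y, V y -> exists B D, frame P y B D.
  exact: new_vertices_frame.
have Vface : forall F, face P F -> exists2 y, V y & F (lat y).
  exact: (new_vertices_face Bf_spec corners ord0).
have edgeP y B D i : frame P y B D -> pairing (row i B) v != 0.
  exact: (admissible_edge _ adm).
have Vnew z i : vertex Q (lat z) -> V (z + dir z i) by move=> vz; exists z, i.
have frnew z i : vertex Q (lat z) ->
    frame P (z + dir z i) (new_basis Bf z i) (@new_dual R 3 Bf z i).
  exact: new_vertex_frame.
have gen1 z i : vertex Q (lat z) -> pairing (dir z i) v != 0.
  move=> vz; have := edgeP _ _ _ i (frnew z i vz).
  by rewrite row_new_basis eqxx.
have gen2 z i j : vertex Q (lat z) -> i != j -> pairing (dir z i) v != pairing (dir z j) v.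
  move=> vz ij; have := edgeP _ _ _ i (frnew z j vz).
  by rewrite row_new_basis (negbTE ij) pairingBl subr_eq0.
(* [M + dir M jm] is the [v]-maximal vertex y* of [P], on edge [jm] of [Q] at [M]. *)
have [M [jm [vM Mmax]]] := truncation_max Bf_spec vR ord0 Q_nonempty.
have [w vw woff] := vertex_off_edge_facets jm vM.
have [i1 [i2 [i3 [v12 v23 i12 i23 i13]]]] :=
  ord3_sort (fun i j => gen2 w i j vw).
pose u : 'cV[R]_3 := - col i2 (Df w).
have frw := fr vw; have [Qw _ wpos _] := frw.
(* [u] is maximal on the facet F through the edges [i1] and [i3] at [w]; [z] is the [v]-maximal
   vertex of F. *)
have [z [_ vz zmax zv]] := lex_max_vertex u vR Q_nonempty.
have zu : pairing (lat z) u = pairing (lat w) u.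
  apply/eqP; rewrite eq_le zmax // andbT; have [Qz _ _ _] := fr vz.
  by rewrite -subr_le0 -pairingBl pairingNr oppr_le0 wpos.
have [k3 [k3neg kzero]] := facet_missing_edge vz vw i12 i23 i13 zu.
have frz := fr vz.
have vneg k : k != k3 -> pairing (dir z k) v < 0.
  move=> /kzero k0; rewrite lt_def eq_sym gen1 //=.
  have := zv _ (new_vertex_hull Bf_spec k vz).
  rewrite lattice_ptD !pairingDl k0 addr0 => /(_ erefl).
  by rewrite gerDl pairing_lattice lerz0.
(* Of the two new vertices near [z] on F, [y] will be the [v]-larger one, along the edge of slower
   descent. *)
have [k1 [k2 [k13 k23 k12 k21]]] : exists k1 k2,
    [/\ k1 != k3, k2 != k3, k1 != k2 & pairing (dir z k2) v < pairing (dir z k1) v].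
  have [a [b [a3 b3 ab]]] := ord3_others k3.
  have := gen2 z a b vz ab; case: ltgtP => // lt _; last by exists a, b.
  by exists b, a; split=> //; rewrite eq_sym.
have rowu x : pairing (x - lat z) u =
    pairing (x - lat z) (col k3 (Df z)) * pairing (lat (dir z k3)) u.
  rewrite (frame_pairing frz) (bigD1 k3) //= big1 ?addr0 // => k /kzero ->.
  by rewrite mulr0.
have k3coord x : pairing x u = pairing (lat w) u ->
    pairing (x - lat z) (col k3 (Df z)) = 0.
  move=> xu; have /eqP := rowu x; rewrite pairingBl xu zu subrr eq_sym mulf_eq0.
  by rewrite (lt_eqF k3neg) orbF => /eqP.
pose y := z + dir z k1; have Vy : V y := Vnew z k1 vz.
have fry : frame P y _ _ := frnew z k1 vz.
have vneg' k : k != k3 -> pairing (row k (new_basis Bf z k1)) v < 0.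
  move=> kk3; rewrite row_new_basis; case: eqVneq => [_|kk1]; first exact: vneg.
  have := ord3_cases k k12 k23 k13; rewrite (negbTE kk1) (negbTE kk3) orbF /=.
  by move=> /eqP ->; rewrite pairingBl subr_lt0.
have vpos : 0 < pairing (row k3 (new_basis Bf z k1)) v.
  rewrite lt_def (edgeP _ _ _ _ fry) /= leNgt; apply/negP => neg.
  (* Otherwise all edges at [y] descend and [y] is y*, so z = M and k1 = jm. Then [woff] puts [w]
     off the facet of coordinate [k3], which is F and contains [w]. *)
  have allneg k : pairing (row k (new_basis Bf z k1)) v < 0.
    by have [->|/vneg'] := eqVneq k k3.
  pose y' := M + dir M jm; have Py' := new_vertex_truncation Bf_spec corners jm vM.
  have [Py _ ypos _] := fry.
  have E : lat y' - lat y = 0.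
    apply: (frame_coord_inj fry) => k; have yk j := ypos _ Py' j.
    have ge0 j : true -> 0 <= pairing (lat y' - lat y) (col j (new_dual R Bf z k1)) *
        - pairing (lat (row j (new_basis Bf z k1))) vR.
      by move=> _; rewrite mulr_ge0 ?yk // oppr_ge0 pairing_lattice lerz0 ltW.
    have le0 : \sum_j pairing (lat y' - lat y) (col j (new_dual R Bf z k1)) *
        - pairing (lat (row j (new_basis Bf z k1))) vR <= 0.
      under eq_bigr do rewrite mulrN.
      by rewrite sumrN -(frame_pairing fry) oppr_le0 pairingBl subr_ge0 Mmax.
    have S0 : \sum_j pairing (lat y' - lat y) (col j (new_dual R Bf z k1)) *
        - pairing (lat (row j (new_basis Bf z k1))) vR = 0.
      by apply/eqP; rewrite eq_le le0 sumr_ge0.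
    have /eqP := psumr_eq0P ge0 S0 (i := k) isT.
    by rewrite mulf_eq0 oppr_eq0 pairing_lattice intr_eq0 (lt_eqF (allneg k)) orbF => /eqP.
  have {}E : y' = y by apply: (@lattice_pt_inj R); apply/eqP; rewrite -subr_eq0 E.
  have zM : z = M.
    apply/eqP; apply: contraT => ne.
    have := corner_disjoint Bf_spec corners vz vM ne (new_vertex_hull Bf_spec k1 vz).
    rewrite (new_vertex_height Bf_spec k1 vz) lexx => /(_ isT).
    by rewrite -/y -E (new_vertex_height Bf_spec jm vM) ltxx.
  have k1E : k1 = jm.
    by apply: (frame_row_inj frz) => /=; move: E; rewrite /y' /y zM => /addrI.
  have := woff k3; rewrite -k1E eq_sym k13 -zM => /(_ isT).
  by rewrite k3coord ?eqxx.
have ycoord a : pairing (lat a - lat y) (col k3 (new_dual R Bf z k1)) =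
    pairing (lat a - lat z) (col k3 (Df z)).
  rewrite col_new_dual eq_sym (negbTE k13) /y lattice_ptD opprD addrA pairingBl.
  by rewrite (frame_dual frz) (negbTE k13) subr0.
have wdir i : pairing (lat (w + dir w i)) u = pairing (lat w) u - (i == i2)%:R.
  by rewrite lattice_ptD pairingDl [X in _ + X]pairingNr (frame_dual frw).
have i32 : i3 != i2 by rewrite eq_sym.
apply: (triangle_not_well_rounded Vfr Vface adm Vy fry vneg' vpos (Vnew w i2 vw)
  (frnew w i2 vw) i12 i32 (Vnew w i1 vw) _ _ (Vnew w i3 vw)).
- by rewrite row_new_basis (negbTE i12) -addrA subrKC.
- by rewrite row_new_basis (negbTE i12) pairingBl subr_lt0.
- by rewrite row_new_basis (negbTE i32) -addrA subrKC.
- by rewrite row_new_basis (negbTE i32) pairingBl subr_gt0.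
- move=> a Va sub.
  have [i ->] : exists i, a = w + dir w i.
    apply: (new_vertices_corner Bf_spec corners Va vw).
    (* The normal cone of the triangle contains minus the cutting functional, so [a] has corner
       height at most 1 at [w]. *)
    have := face_cone_dual (frnew w i2 vw) (_ : ~~ predC1 i2 i2).
    rewrite /= eqxx => /(_ isT)/sub/vconeP.
    move=> /(_ _ (new_vertex_truncation Bf_spec corners i2 vw)).
    rewrite col_new_dual eqxx !pairingNr lerN2.
    have := new_vertex_height Bf_spec i2 vw; rewrite /corner_height !pairingBl.
    by move=> <-; rewrite lerD2r.
  by rewrite !inE; have := ord3_cases i i12 i23 i13 => /or3P[] /eqP ->; rewrite eqxx ?orbT.
- by rewrite ycoord k3coord // wdir (negbTE i12) subr0.
- by rewrite ycoord k3coord // wdir (negbTE i32) subr0.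
rewrite ycoord; apply/eqP => E; have := rowu (lat (w + dir w i2)).
rewrite E mul0r pairingBl wdir zu eqxx => /eqP.
by rewrite addrAC subrr add0r oppr_eq0 oner_eq0.
Qed.

End Pop.

Theorem proposition7p19 (R : realType) (K : closedFieldType)
    (P0 P : set 'rV[R]_3) :
  smooth_polytope P0 ->
  ~ (exists F1 F2 : set 'rV[R]_3,
       adjacent_facets P0 F1 F2 /\
       forall w : 'rV[R]_3, vertex P0 w -> F1 w \/ F2 w) ->
  is_Pop P0 P ->
  ~ (exists v : 'cV[int]_3,
       polytope_admissible K P v /\ polytope_well_rounded K P v).
Proof.
move=> smooth0 nocov0 [k [k0 corners ->]] [v [adm wr]].
have c0 : 0 < k%:R :> R by rewrite ltr0n.
have c'0 : 0 < k%:R^-1 :> R by rewrite invr_gt0.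
have cn : k%:R != 0 :> R by rewrite gt_eqF.
have nocov : ~ (exists F1 F2 : set 'rV[R]_3, adjacent_facets (dilation k P0) F1 F2 /\
    forall w, vertex (dilation k P0) w -> F1 w \/ F2 w).
  move=> [F1 [F2 [adj cov]]]; apply: nocov0.
  exists (scale_set k%:R^-1 F1), (scale_set k%:R^-1 F2); split.
    by rewrite -(scale_setK P0 cn) -dilation_scale; apply: scale_adjacent_facets.
  move=> w /(scale_vertex c0); rewrite -dilation_scale => /cov.
  by case=> H; [left|right]; apply/(scale_setP _ _ (invr_neq0 cn)); rewrite invrK.
have := dilation_smooth k0 smooth0.
move: (dilation k P0) corners adm wr nocov => Q corners adm wr nocov.
move=> [[s QE] [x0 [_ [Qx0 _ _ _]]] sQ].
have /choice[Bf HB] : forall z : 'rV[int]_3, exists B : 'M[int]_3,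
    vertex Q (lattice_pt R z) -> B \in unitmx /\
    forall e, edge_direction Q (lattice_pt R z) e <-> exists i, e = row i B.
  move=> z; have [/sQ[B Bu HB]|nv] := EM (vertex Q (lattice_pt R z)); first by exists B.
  (* A default value: nothing is claimed away from the vertices. *)
  by exists 0.
rewrite {}QE in corners adm wr nocov Qx0 HB.
exact: (truncation_not_well_rounded HB corners (ex_intro _ x0 Qx0) nocov adm wr).
Qed.
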